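(* Let $R$ be a PID and let $(X,r)$ be a ray-based, metrizable generalized continuum. Then there is an exact sequence of free $R$-modules of countable rank $$0\leftarrow H^0_{\mathrm e}(r)\leftarrow H^0_{\mathrm e}(X)\leftarrow\widetilde H^0_{\mathrm e}(X)\leftarrow 0$$ that splits naturally in $(X,r)$. Further, $$|E(X)|=\operatorname{rank}H^0_{\mathrm e}(X)=\operatorname{rank}\widetilde H^0_{\mathrm e}(X)+1,$$ where infinities are not distinguished (i.e., the quantities are either all finite and equal, or all infinite).
   Context: Spaces are Hausdorff and maps are continuous; a map is proper if preimages of compacta are compact. A generalized continuum is a Hausdorff space that is connected, locally connected, $\sigma$-compact, and locally compact. A baseray in $X$ is a proper embedding $r:[0,\infty)\to X$, identified with its (closed) image; a ray-based space is a pair $(X,r)$. A proper map $f:(Y,s)\to(X,r)$ is ray-based if $r=f\circ s$. ''Splits naturally'' means that there are splitting homomorphisms commuting with the maps induced by ray-based proper maps of ray-based, metrizable generalized continua. ''Countable'' means finite or countably infinite. Cohomology is singular with coefficients in $R$. For $A\subseteq X$ closed, $H^{\ast}_{\mathrm e}(X,A)=\varinjlim_K H^{\ast}(X-K,A-K)$ over compacta $K\subseteq X$ ordered by inclusion, with restriction homomorphisms; $H^{\ast}_{\mathrm e}(X)=H^{\ast}_{\mathrm e}(X,\emptyset)$; $\widetilde H^{\ast}_{\mathrm e}(X)=H^{\ast}_{\mathrm e}(X,r)$; $H^{\ast}_{\mathrm e}(r)$ is the end cohomology of the image of $r$. $E(X)$ is the set of ends of $X$: for a compact exhaustion $\{K_i\}$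 of $X$ (nested compacta covering $X$ with $K_i\subseteq\mathrm{Int}\,K_{i+1}$), an end is a sequence $W_1\supseteq W_2\supseteq\cdots$ with $W_i$ an unbounded component of $X-K_i$ (unbounded: noncompact closure in $X$). Its cardinality is independent of the exhaustion. *)

(* Defs.v *)
From HB Require Import structures.
From mathcomp Require Import all_boot all_order all_algebra.
From mathcomp Require Import generic_quotient ring_quotient.
From mathcomp Require Import all_classical all_reals all_analysis.

Set Implicit Arguments.
Unset Strict Implicit.
Unset Printing Implicit Defensive.

Import Order.TTheory GRing.Theory Num.Theory.
Import numFieldTopology.Exports.

Local Open Scope classical_set_scope.
Local Open Scope ring_scope.
Local Open Scope quotient_scope.

Section module_notions.
Variables (R : nzRingType) (M : lmodType R).

Definition linearly_independent (B : set M) :=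
  forall (n : nat) (b : 'I_n -> M) (c : 'I_n -> R),
    injective b -> (forall i, B (b i)) ->
    \sum_(i < n) c i *: b i = 0 -> forall i, c i = 0.

Definition spanning (B : set M) :=
  forall x : M, exists (n : nat) (b : 'I_n -> M) (c : 'I_n -> R),
    (forall i, B (b i)) /\ x = \sum_(i < n) c i *: b i.

Definition is_basis (B : set M) := linearly_independent B /\ spanning B.

Definition free_of_countable_rank := exists B, is_basis B /\ countable B.

(* The number of elements of a chosen basis; over a nonzero commutative ring it
   does not depend on the choice.  [counting] is [+oo] on every infinite set, so
   infinite ranks are not distinguished. *)
Definition module_rank (K : realType) : \bar K :=
  counting (xget set0 [set B | is_basis B]).

End module_notions.

Definition principal_ideal_domain (R : idomainType) :=
  forall I : set R,
    [/\ I 0, forall x y, I x -> I y -> I (x + y) & forall a x, I x -> I (a * x)] ->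
    exists g : R, I = [set a * g | a in setT].

Definition short_exact (R : nzRingType) (L M N : lmodType R)
    (f : L -> M) (g : M -> N) :=
  [/\ injective f, forall y, g y = 0 <-> exists x, f x = y &
      forall z, exists y, g y = z].

Section quotient_module.
Variables (R : nzRingType) (M : lmodType R) (N : submodClosed M).

Let oppN x : x \in N -> - x \in N.
Proof. by move=> Nx; rewrite -scaleN1r rpredZ. Qed.

Definition quotient_rel : rel M := fun x y => x - y \in N.

Fact quotient_rel_refl : reflexive quotient_rel.
Proof. by move=> x; rewrite /quotient_rel subrr rpred0. Qed.

Fact quotient_rel_sym : symmetric quotient_rel.
Proof. by move=> x y; apply/idP/idP => /oppN; rewrite opprB. Qed.

Fact quotient_rel_trans : transitive quotient_rel.
Proof.
by move=> y x z xy yz; rewrite /quotient_rel -[x](addrNK y) -addrA rpredD.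
Qed.

Canonical quotient_equiv :=
  EquivRel quotient_rel quotient_rel_refl quotient_rel_sym quotient_rel_trans.

Definition quotient_module := {eq_quot quotient_rel}.

HB.instance Definition _ := Choice.on quotient_module.

Definition qproj (x : M) : quotient_module := \pi_({eq_quot quotient_rel}) x.

Lemma qprojP x y : (qproj x = qproj y) <-> (x - y \in N).
Proof. by split=> [/eqmodP|h] //; apply/eqmodP. Qed.

Lemma qproj_repr (x : quotient_module) : qproj (repr x) = x.
Proof. exact: reprK. Qed.

Definition qadd (x y : quotient_module) := qproj (repr x + repr y).
Definition qopp (x : quotient_module) := qproj (- repr x).

Lemma qaddE x y : qadd (qproj x) (qproj y) = qproj (x + y).
Proof.
by apply/qprojP; rewrite opprD addrACA rpredD//; apply/qprojP; rewrite qproj_repr.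
Qed.

Lemma qoppE x : qopp (qproj x) = qproj (- x).
Proof.
by apply/qprojP; rewrite -opprD oppN//; apply/qprojP; rewrite qproj_repr.
Qed.

Fact qaddA : associative qadd.
Proof.
move=> x y z; rewrite -(qproj_repr x) -(qproj_repr y) -(qproj_repr z).
by rewrite !qaddE addrA.
Qed.

Fact qaddC : commutative qadd.
Proof. by move=> x y; rewrite /qadd addrC. Qed.

Fact qadd0 : left_id (qproj 0) qadd.
Proof. by move=> x; rewrite -(qproj_repr x) qaddE add0r. Qed.

Fact qaddN : left_inverse (qproj 0) qopp qadd.
Proof. by move=> x; rewrite -(qproj_repr x) qoppE qaddE addNr. Qed.

HB.instance Definition _ :=
  GRing.isZmodule.Build quotient_module qaddA qaddC qadd0 qaddN.

Lemma qprojD x y : qproj (x + y) = qproj x + qproj y.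
Proof. by rewrite [RHS]/GRing.add/= qaddE. Qed.

Definition qscale (a : R) (x : quotient_module) := qproj (a *: repr x).

Lemma qscaleE a x : qscale a (qproj x) = qproj (a *: x).
Proof.
apply/qprojP; rewrite -scalerBr; apply: rpredZ.
by apply/qprojP; rewrite qproj_repr.
Qed.

Fact qscaleA a b x : qscale a (qscale b x) = qscale (a * b) x.
Proof. by rewrite -(qproj_repr x) !qscaleE scalerA. Qed.

Fact qscale1 : left_id 1 qscale.
Proof. by move=> x; rewrite -(qproj_repr x) !qscaleE scale1r. Qed.

Fact qscaleDr : right_distributive qscale +%R.
Proof.
move=> a x y; rewrite -(qproj_repr x) -(qproj_repr y).
by rewrite -qprojD !qscaleE scalerDr qprojD.
Qed.

Fact qscaleDl x : {morph qscale^~ x : a b / a + b}.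
Proof.
by move=> a b; rewrite -(qproj_repr x) !qscaleE scalerDl qprojD.
Qed.

HB.instance Definition _ := GRing.Zmodule_isLmodule.Build R quotient_module
  qscaleA qscale1 qscaleDr qscaleDl.

Fact qproj_linear : linear qproj.
Proof. by move=> a x y; rewrite qprojD -qscaleE. Qed.

HB.instance Definition _ := GRing.isLinear.Build R M quotient_module _ qproj
  qproj_linear.

End quotient_module.

Section quotient_map.
Variables (R : nzRingType) (M M' : lmodType R).
Variables (N : submodClosed M) (N' : submodClosed M').
Variable f : {linear M -> M'}.

Definition qmap of (forall x, x \in N -> f x \in N') :=
  fun x : quotient_module N => qproj N' (f (repr x)).

Hypothesis fN : forall x, x \in N -> f x \in N'.

Lemma qmapE x : qmap fN (qproj N x) = qproj N' (f x).
Proof. by apply/qprojP; rewrite -linearB; apply/fN/qprojP/qproj_repr. Qed.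

Fact qmap_linear : linear (qmap fN).
Proof.
move=> a x y; rewrite -(qproj_repr x) -(qproj_repr y) -linearP !qmapE.
by rewrite !linearP.
Qed.

HB.instance Definition _ := GRing.isLinear.Build R _ _ _ (qmap fN) qmap_linear.

End quotient_map.

Record directed_system (R : nzRingType) := DirectedSystem {
  ds_index : Type;
  ds_le : ds_index -> ds_index -> Prop;
  ds_inh : ds_index;
  ds_refl : forall i, ds_le i i;
  ds_trans : forall i j k, ds_le i j -> ds_le j k -> ds_le i k;
  ds_directed : forall i j, exists k, ds_le i k /\ ds_le j k;
  ds_obj : ds_index -> lmodType R;
  ds_map : forall i j, ds_le i j -> {linear ds_obj i -> ds_obj j};
  ds_map_id : forall i (h : ds_le i i) x, ds_map h x = x;
  ds_map_comp : forall i j k (hij : ds_le i j) (hjk : ds_le j k)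
    (hik : ds_le i k) x, ds_map hjk (ds_map hij x) = ds_map hik x
}.

Section direct_limit.
Variables (R : nzRingType) (D : directed_system R).
Local Notation I := (ds_index D).
Local Notation M := (ds_obj (d := D)).
Local Notation le := (ds_le (d := D)).

Definition germ := {classic {i : I & M i}}.

Definition mkgerm (i : I) (x : M i) : germ := existT (fun i => M i : Type) i x.

Definition germ_eqv (p q : germ) : Prop :=
  exists k (hp : le (projT1 p) k) (hq : le (projT1 q) k),
    ds_map hp (projT2 p) = ds_map hq (projT2 q).

Definition germ_rel : rel germ := fun p q => `[< germ_eqv p q >].

Fact germ_rel_refl : reflexive germ_rel.
Proof. by move=> p; apply/asboolP; exists (projT1 p), (ds_refl _), (ds_refl _). Qed.

Fact germ_rel_sym : symmetric germ_rel.
Proof.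
move=> p q; apply/asboolP/asboolP => -[k [hp [hq e]]]; by exists k, hq, hp.
Qed.

Fact germ_rel_trans : transitive germ_rel.
Proof.
move=> q p r /asboolP [k [hp [hq e]]] /asboolP [l [hq' [hr e']]].
apply/asboolP; have [m [hk hl]] := ds_directed k l.
exists m, (ds_trans hp hk), (ds_trans hr hl).
rewrite -(ds_map_comp hp hk) e (ds_map_comp hq hk (ds_trans hq hk)).
by rewrite -(ds_map_comp hr hl) -e' (ds_map_comp hq' hl (ds_trans hq hk)).
Qed.

Canonical germ_equiv := EquivRel germ_rel germ_rel_refl germ_rel_sym germ_rel_trans.

Definition direct_limit := {eq_quot germ_rel}.

HB.instance Definition _ := Choice.on direct_limit.

Definition dl_inj (i : I) (x : M i) : direct_limit :=
  \pi_({eq_quot germ_rel}) (mkgerm x).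

Lemma dl_injP i j (x : M i) (y : M j) :
  dl_inj x = dl_inj y <->
  exists k (hi : le i k) (hj : le j k), ds_map hi x = ds_map hj y.
Proof.
split=> [/eqmodP/asboolP //|h]; by apply/eqmodP/asboolP.
Qed.

Lemma dl_inj_map i j (h : le i j) (x : M i) : dl_inj (ds_map h x) = dl_inj x.
Proof.
apply/dl_injP; exists j, (ds_refl j), h; by rewrite ds_map_id.
Qed.

Lemma dl_injW (x : direct_limit) : exists i (y : M i), x = dl_inj y.
Proof.
by rewrite -[x]reprK; case: (repr x) => i y; exists i, y.
Qed.

Lemma dl_injW2 (x y : direct_limit) :
  exists i (x' y' : M i), x = dl_inj x' /\ y = dl_inj y'.
Proof.
have [i [x' ->]] := dl_injW x; have [j [y' ->]] := dl_injW y.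
have [k [hi hj]] := ds_directed i j.
by exists k, (ds_map hi x'), (ds_map hj y'); rewrite !dl_inj_map.
Qed.

Lemma dl_injW3 (x y z : direct_limit) : exists i (x' y' z' : M i),
  [/\ x = dl_inj x', y = dl_inj y' & z = dl_inj z'].
Proof.
have [i [x' [y' [-> ->]]]] := dl_injW2 x y; have [j [z' ->]] := dl_injW z.
have [k [hi hj]] := ds_directed i j.
exists k, (ds_map hi x'), (ds_map hi y'), (ds_map hj z').
by rewrite !dl_inj_map.
Qed.

Definition ds_join (i j : I) : {k | le i k /\ le j k} := cid (ds_directed i j).

Definition dl_add (x y : direct_limit) : direct_limit :=
  let p := repr x in let q := repr y in
  let: exist _ h := ds_join (projT1 p) (projT1 q) in
  dl_inj (ds_map (proj1 h) (projT2 p) + ds_map (proj2 h) (projT2 q)).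
Definition dl_opp (x : direct_limit) : direct_limit :=
  dl_inj (- projT2 (repr x)).
Definition dl_scale (a : R) (x : direct_limit) : direct_limit :=
  dl_inj (a *: projT2 (repr x)).
Definition dl_zero : direct_limit := dl_inj (0 : M (ds_inh D)).

Lemma dl_zeroE i : dl_zero = dl_inj (0 : M i).
Proof.
have [k [h h']] := ds_directed (ds_inh D) i.
by apply/dl_injP; exists k, h, h'; rewrite !linear0.
Qed.

Lemma dl_scaleE a i (x : M i) : dl_scale a (dl_inj x) = dl_inj (a *: x).
Proof.
rewrite /dl_scale; have : dl_inj (projT2 (repr (dl_inj x))) = dl_inj x.
  by rewrite -[RHS]reprK; case: (repr _).
move=> /dl_injP[k [h [h' e]]]; apply/dl_injP; exists k, h, h'.
by rewrite !linearZ/= e.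
Qed.

Lemma dl_oppE i (x : M i) : dl_opp (dl_inj x) = dl_inj (- x).
Proof.
by rewrite -scaleN1r -dl_scaleE /dl_opp /dl_scale scaleN1r.
Qed.

Lemma dl_addE i (x y : M i) : dl_add (dl_inj x) (dl_inj y) = dl_inj (x + y).
Proof.
rewrite /dl_add.
have rE (z : M i) : dl_inj (projT2 (repr (dl_inj z))) = dl_inj z.
  by rewrite -[RHS]reprK; case: (repr _).
have := rE x; have := rE y.
case: (repr (dl_inj x)) => j x' /=; case: (repr (dl_inj y)) => l y' /=.
case: (ds_join j l) => m h /=.
move=> /dl_injP[k [h1 [h2 e2]]] /dl_injP[k' [h1' [h2' e1]]].
have [p [kp k'p]] := ds_directed k k'.
have [q [pq mq]] := ds_directed p m.
have iq : le i q := ds_trans (ds_trans h2 kp) pq.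
apply/dl_injP; exists q, mq, iq; rewrite !linearD/=.
have kq := ds_trans kp pq; have k'q := ds_trans k'p pq.
congr (_ + _).
  by rewrite (ds_map_comp (proj1 h) mq (ds_trans h1' k'q)) -(ds_map_comp h1' k'q) e1
     (ds_map_comp h2' k'q iq).
by rewrite (ds_map_comp (proj2 h) mq (ds_trans h1 kq)) -(ds_map_comp h1 kq) e2
  (ds_map_comp h2 kq iq).
Qed.

Fact dl_addA : associative dl_add.
Proof.
move=> x y z; have [i [x' [y' [z' [-> -> ->]]]]] := dl_injW3 x y z.
by rewrite !dl_addE addrA.
Qed.

Fact dl_addC : commutative dl_add.
Proof.
move=> x y; have [i [x' [y' [-> ->]]]] := dl_injW2 x y.
by rewrite !dl_addE addrC.
Qed.

Fact dl_add0 : left_id dl_zero dl_add.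
Proof.
move=> x; have [i [y ->]] := dl_injW x.
by rewrite (dl_zeroE i) dl_addE add0r.
Qed.

Fact dl_addN : left_inverse dl_zero dl_opp dl_add.
Proof.
move=> x; have [i [y ->]] := dl_injW x.
by rewrite (dl_zeroE i) dl_oppE dl_addE addNr.
Qed.

HB.instance Definition _ :=
  GRing.isZmodule.Build direct_limit dl_addA dl_addC dl_add0 dl_addN.

Fact dl_scaleA a b x : dl_scale a (dl_scale b x) = dl_scale (a * b) x.
Proof. by have [i [y ->]] := dl_injW x; rewrite !dl_scaleE scalerA. Qed.

Fact dl_scale1 : left_id 1 dl_scale.
Proof.
by move=> x; have [i [y ->]] := dl_injW x; rewrite dl_scaleE scale1r.
Qed.

Fact dl_scaleDr : right_distributive dl_scale +%R.
Proof.
move=> a x y; have [i [x' [y' [-> ->]]]] := dl_injW2 x y.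
by rewrite /GRing.add/= !dl_scaleE !dl_addE dl_scaleE scalerDr.
Qed.

Fact dl_scaleDl x : {morph dl_scale^~ x : a b / a + b}.
Proof.
move=> a b; have [i [y ->]] := dl_injW x.
by rewrite [RHS]/GRing.add/= !dl_scaleE dl_addE scalerDl.
Qed.

HB.instance Definition _ := GRing.Zmodule_isLmodule.Build R direct_limit
  dl_scaleA dl_scale1 dl_scaleDr dl_scaleDl.

Lemma dl_inj_linear i : linear (@dl_inj i).
Proof.
move=> a x y; rewrite [RHS]/GRing.add/= [X in dl_add X]/GRing.scale/=.
by rewrite dl_scaleE dl_addE.
Qed.

HB.instance Definition _ i := GRing.isLinear.Build R _ _ _ (@dl_inj i)
  (@dl_inj_linear i).

End direct_limit.

Section direct_limit_map.
Variables (R : nzRingType) (D E : directed_system R).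

Record system_map := SystemMap {
  sm_index : ds_index D -> ds_index E;
  sm_mono : forall i j, ds_le i j -> ds_le (sm_index i) (sm_index j);
  sm_map : forall i, {linear ds_obj i -> ds_obj (sm_index i)};
  sm_compat : forall i j (h : ds_le i j) x,
    ds_map (sm_mono h) (sm_map i x) = sm_map j (ds_map h x)
}.

Variable f : system_map.

Definition dl_map (x : direct_limit D) : direct_limit E :=
  dl_inj (sm_map f (projT1 (repr x)) (projT2 (repr x))).

Lemma dl_mapE i (x : ds_obj i) : dl_map (dl_inj x) = dl_inj (sm_map f i x).
Proof.
rewrite /dl_map; have : dl_inj (projT2 (repr (dl_inj x))) = dl_inj x.
  by rewrite -[RHS]reprK; case: (repr _).
move=> /dl_injP[k [h [h' e]]]; apply/dl_injP.
by exists (sm_index f k), (sm_mono f h), (sm_mono f h'); rewrite !sm_compat e.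
Qed.

Fact dl_map_linear : linear dl_map.
Proof.
move=> a x y; have [i [x' [y' [-> ->]]]] := dl_injW2 x y.
by rewrite -linearP !dl_mapE !linearP.
Qed.

HB.instance Definition _ := GRing.isLinear.Build R _ _ _ dl_map dl_map_linear.

End direct_limit_map.

Section standard_simplex.
Variable K : realType.

Definition simplex_set n : set 'rV[K]_n.+1 :=
  [set t | (forall i, 0 <= t 0 i) /\ \sum_(i < n.+1) t 0 i = 1].

Definition simplex n : topologicalType := set_type (@simplex_set n).

Section face.
Variables (n : nat) (i : 'I_n.+2).

Definition face_row (t : 'rV[K]_n.+1) : 'rV[K]_n.+2 :=
  \row_j oapp (t 0) 0 (unlift i j).

Fact face_subproof (t : simplex n) : face_row (val t) \in @simplex_set n.+1.
Proof.
case: t => t /= /set_mem[t0 t1]; apply/mem_set; split=> [j|].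
  by rewrite mxE; case: (unlift i j).
rewrite (bigD1_ord i)//= mxE unlift_none add0r -t1.
by apply: eq_bigr => j _; rewrite mxE liftK.
Qed.

Definition face (t : simplex n) : simplex n.+1 :=
  exist (fun u => u \in @simplex_set n.+1) (face_row (val t)) (face_subproof t).

Fact face_continuous : continuous face.
Proof.
apply: continuous_comp_initial => t A [P nP sPA].
apply: (@filterS _ _ _ ((val : simplex n -> 'rV[K]_n.+1) @^-1`
    [set M | forall a b, P a b (face_row M a b)])) => [u Pu|]; first exact: sPA.
apply: (@initial_continuous _ _ (val : simplex n -> 'rV[K]_n.+1) t).
exists (fun a c => P a (lift i c)) => [a c|M PM a b].
  by have := nP a (lift i c); rewrite /= mxE liftK (ord1 a).
rewrite (ord1 a) mxE; case: (unliftP i b) => [c|] -> /=.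
  exact: PM.
by have := nP 0 i; rewrite /= mxE unlift_none => /nbhs_singleton.
Qed.

HB.instance Definition _ := isContinuous.Build _ _ face face_continuous.

End face.
End standard_simplex.

Section singular_cohomology.
Variables (K : realType) (R : nzRingType).

(* A singular simplex of a subspace U of X is a singular simplex of X with image
   in U; no separate type is used for the subspace. *)
Definition singular_simplex (X : topologicalType) (U : set X) (n : nat) :=
  {s : continuousType (simplex K n) X | range s `<=` U}.

Section one_pair.
Variables (X : topologicalType) (U A : set X).

Fact simplex_face_subproof n (i : 'I_n.+2) (s : singular_simplex U n.+1) :
  range ((sval s \o face i) : continuousType (simplex K n) X) `<=` U.
Proof. by move=> _ [t _ <-]; apply: (svalP s); exists (face i t). Qed.

Definition simplex_face n (i : 'I_n.+2) (s : singular_simplex U n.+1) :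
  singular_simplex U n :=
  exist (fun s : continuousType (simplex K n) X => range s `<=` U) _
    (@simplex_face_subproof n i s).

(* Singular chains being free on singular simplices, a cochain is a function of
   singular simplices, and a cochain of the pair (U, A) is one that vanishes on
   the singular simplices of A. *)
Definition cochain n := singular_simplex U n -> R^o.

Definition relative n (c : cochain n) :=
  forall s : singular_simplex U n, range (sval s) `<=` A -> c s = 0.

Definition coboundary n (c : cochain n) : cochain n.+1 :=
  fun s => \sum_(i < n.+2) (-1) ^+ i * c (simplex_face i s).

Fact coboundary_linear n : linear (@coboundary n).
Proof.
move=> a c d; apply/funext => s.
rewrite -[RHS]/(a * coboundary c s + coboundary d s) /coboundary.
rewrite mulr_sumr -big_split; apply: eq_bigr => i _ /=.
rewrite -[X in _ * X]/(a * c (simplex_face i s) + d (simplex_face i s)).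
by rewrite mulrDr !mulrA [a * _]commr_sign.
Qed.

HB.instance Definition _ n := GRing.isLinear.Build R _ _ _ (@coboundary n)
  (@coboundary_linear n).

Definition is_cocycle n : {pred cochain n} :=
  fun c => `[< relative c /\ coboundary c = 0 >].

Fact is_cocycle_submod n : submod_closed (@is_cocycle n).
Proof.
split; first by apply/asboolP; split=> //; rewrite linear0.
move=> a c d /asboolP[c1 c2] /asboolP[d1 d2]; apply/asboolP; split.
  move=> s sA; rewrite -[LHS]/(a *: c s + d s) (c1 s sA) (d1 s sA).
  by rewrite scaler0 addr0.
by rewrite linearP/= c2 d2 scaler0 addr0.
Qed.

HB.instance Definition _ n := GRing.isSubmodClosed.Build R (cochain n)
  (@is_cocycle n) (@is_cocycle_submod n).

Record cocycle n := Cocycle {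
  cocycle_val :> cochain n;
  cocycleP : cocycle_val \in @is_cocycle n
}.

HB.instance Definition _ n := [isSub for @cocycle_val n].
HB.instance Definition _ n := [Choice of cocycle n by <:].
HB.instance Definition _ n := [SubChoice_isSubLmodule of cocycle n by <:].

Lemma cocycle_val_linear n : linear (@cocycle_val n).
Proof. exact: (linearP (val : cocycle n -> cochain n)). Qed.

HB.instance Definition _ n := GRing.isLinear.Build R (cocycle n) (cochain n) _
  (@cocycle_val n) (@cocycle_val_linear n).

Definition is_coboundary n : {pred cocycle n} :=
  match n with
  | 0 => fun c => `[< cocycle_val c = 0 >]
  | m.+1 => fun c =>
      `[< exists b : cochain m, relative b /\ cocycle_val c = coboundary b >]
  end.

Fact is_coboundary_submod n : submod_closed (@is_coboundary n).
Proof.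
case: n => [|n]; split; first exact/asboolP.
- move=> a c d /asboolP c0 /asboolP d0; apply/asboolP.
  by rewrite linearP/= c0 d0 scaler0 addr0.
- by apply/asboolP; exists 0; split=> //; rewrite !linear0.
move=> a c d /asboolP[b [b1 b2]] /asboolP[e [e1 e2]]; apply/asboolP.
exists (a *: b + e); split.
  move=> s sA; rewrite -[LHS]/(a *: b s + e s) (b1 s sA) (e1 s sA).
  by rewrite scaler0 addr0.
by rewrite !linearP/= b2 e2.
Qed.

HB.instance Definition _ n := GRing.isSubmodClosed.Build R (cocycle n)
  (@is_coboundary n) (@is_coboundary_submod n).

Definition cohomology n := quotient_module (@is_coboundary n).

HB.instance Definition _ n := GRing.Lmodule.on (cohomology n).

End one_pair.

Record pair_map (X Y : topologicalType) (U A : set X) (V B : set Y) := PairMap {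
  pm_fun :> continuousType X Y;
  pm_space : forall x, U x -> V (pm_fun x);
  pm_sub : forall x, A x -> B (pm_fun x)
}.

Section induced_map.
Variables (X Y : topologicalType) (U A : set X) (V B : set Y).
Variable f : pair_map U A V B.

Fact simplex_map_subproof n (s : singular_simplex U n) :
  range ((f \o sval s) : continuousType (simplex K n) Y) `<=` V.
Proof. by move=> _ [t _ <-]; apply: pm_space; apply: (svalP s); exists t. Qed.

Definition simplex_map n (s : singular_simplex U n) : singular_simplex V n :=
  exist (fun s : continuousType (simplex K n) Y => range s `<=` V) _
    (@simplex_map_subproof n s).

Lemma simplex_face_map n i (s : singular_simplex U n.+1) :
  simplex_face i (simplex_map s) = simplex_map (simplex_face i s).
Proof. by apply/eq_exist/continuousEP. Qed.

Fact cocycle_map_subproof n (c : cocycle V B n) :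
  ((fun s => cocycle_val c (simplex_map s)) : cochain U n) \in @is_cocycle X U A n.
Proof.
case: c => c /= /asboolP[c1 c2]; apply/asboolP; split.
  move=> s sA; apply: c1 => _ [t _ <-]; apply: pm_sub.
  by apply: sA; exists t.
apply/funext => s; rewrite -[RHS]/((0 : cochain V n.+1) (simplex_map s)) -c2.
by apply: eq_bigr => i _; rewrite simplex_face_map.
Qed.

Definition cocycle_map n (c : cocycle V B n) : cocycle U A n :=
  Cocycle (cocycle_map_subproof c).

Fact cocycle_map_linear n : linear (@cocycle_map n).
Proof.
move=> a c d; apply: val_inj; rewrite [RHS](cocycle_val_linear a)/=.
apply/funext => s.
exact: (congr1 (fun h : cochain V n => h (simplex_map s))
  (cocycle_val_linear a c d)).
Qed.

HB.instance Definition _ n := GRing.isLinear.Build R _ _ _ (@cocycle_map n)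
  (@cocycle_map_linear n).

Fact cocycle_map_coboundary n (c : cocycle V B n) :
  c \in @is_coboundary Y V B n -> cocycle_map c \in @is_coboundary X U A n.
Proof.
case: n c => [|n] c /asboolP; rewrite /is_coboundary.
  by move=> c0; apply/asboolP/funext => s; rewrite /= c0.
move=> [b [b1 b2]]; apply/asboolP; exists (fun s => b (simplex_map s)); split.
  move=> s sA; apply: b1 => _ [t _ <-]; apply: pm_sub.
  by apply: sA; exists t.
apply/funext => s; rewrite /= b2.
by apply: eq_bigr => i _; rewrite simplex_face_map.
Qed.

Definition cohomology_map n : cohomology V B n -> cohomology U A n :=
  qmap (@cocycle_map_coboundary n).

HB.instance Definition _ n := GRing.Linear.on (@cohomology_map n).

End induced_map.

Lemma cohomology_mapE (X Y : topologicalType) (U A : set X) (V B : set Y)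
    (f : pair_map U A V B) n (c : cocycle V B n) :
  cohomology_map f (qproj (@is_coboundary Y V B n) c) =
  qproj (@is_coboundary X U A n) (cocycle_map f c).
Proof. exact: qmapE. Qed.

Lemma cohomology_map_comp (X Y Z : topologicalType) (U A : set X) (V B : set Y)
    (W C : set Z) (f : pair_map U A V B) (g : pair_map V B W C)
    (h : pair_map U A W C) n (x : cohomology W C n) :
  (forall t, h t = g (f t)) ->
  cohomology_map f (cohomology_map g x) = cohomology_map h x.
Proof.
move=> hE; rewrite -(qproj_repr x); move: (repr x) => c.
rewrite (cohomology_mapE g) (cohomology_mapE f) (cohomology_mapE h).
congr qproj.
apply: val_inj; apply/funext => s /=; congr (cocycle_val _ _).
by apply/eq_exist/continuousEP => t /=; rewrite hE.
Qed.

Lemma cohomology_map_id (X : topologicalType) (U A : set X)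
    (f : pair_map U A U A) n (x : cohomology U A n) :
  (forall t, f t = t) -> cohomology_map f x = x.
Proof.
move=> fE; rewrite -(qproj_repr x); move: (repr x) => c.
rewrite (cohomology_mapE f); congr qproj.
apply: val_inj; apply/funext => s /=; congr (cocycle_val _ _).
by case: s => s sU; apply/eq_exist/continuousEP => t /=; rewrite fE.
Qed.

Section end_cohomology.
Variables (X : topologicalType) (S A : set X) (n : nat).

Definition compact_in := {L : set X | compact L /\ L `<=` S}.

Definition compact_le (L M : compact_in) := sval L `<=` sval M.

Definition compact_inh : compact_in :=
  exist (fun L : set X => compact L /\ L `<=` S) set0
    (conj (@compact0 X) (@sub0set _ S)).

Fact compact_le_refl L : compact_le L L. Proof. by []. Qed.

Fact compact_le_trans L M N :
  compact_le L M -> compact_le M N -> compact_le L N.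
Proof. exact: subset_trans. Qed.

Fact compact_le_directed L M : exists N, compact_le L N /\ compact_le M N.
Proof.
case: L M => L [cL LS] [M [cM MS]].
have h : compact (L `|` M) /\ L `|` M `<=` S.
  by split; [exact: compactU|rewrite subUset].
by exists (exist (fun L => compact L /\ L `<=` S) _ h); split => x Lx /=; [left|right].
Qed.

Definition complement_cohomology (L : compact_in) : lmodType R :=
  cohomology (S `\` sval L) (A `\` sval L) n.

Fact complement_subproof (D : set X) (L M : compact_in) : compact_le L M ->
  forall x, (D `\` sval M) x -> (D `\` sval L) (@idfun X x).
Proof. by move=> LM x [Dx Mx]; split=> // /LM. Qed.

Definition complement_inclusion (L M : compact_in) (h : compact_le L M) :
    pair_map (S `\` sval M) (A `\` sval M) (S `\` sval L) (A `\` sval L) :=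
  @PairMap _ _ _ _ _ _ (@idfun X) (complement_subproof h)
    (complement_subproof h).

Definition restriction (L M : compact_in) (h : compact_le L M) :
    {linear complement_cohomology L -> complement_cohomology M} :=
  @cohomology_map _ _ _ _ _ _ (complement_inclusion h) n.

Fact restriction_id L (h : compact_le L L) x : restriction h x = x.
Proof. exact: cohomology_map_id. Qed.

Fact restriction_comp L M N (h1 : compact_le L M) (h2 : compact_le M N)
  (h3 : compact_le L N) x : restriction h2 (restriction h1 x) = restriction h3 x.
Proof. exact: cohomology_map_comp. Qed.

Definition end_system : directed_system R :=
  DirectedSystem compact_inh compact_le_refl compact_le_trans
    compact_le_directed restriction_id restriction_comp.

(* The compacta range over those of the subspace S, so that [S] may be any
   closed subspace of [X], in particular the image of a ray. *)
Definition end_cohomology : lmodType R := direct_limit end_system.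

End end_cohomology.

(* A map of pairs (S, A) -> (T, B) of subspaces whose restriction S -> T is
   proper. *)
Record proper_pair_map (X Y : topologicalType) (S A : set X) (T B : set Y) :=
ProperPairMap {
  ppm_fun :> pair_map S A T B;
  ppm_pair : A `<=` S;
  ppm_proper : forall L, compact L -> L `<=` T -> compact (S `&` ppm_fun @^-1` L)
}.

Section end_induced_map.
Variables (X Y : topologicalType) (S A : set X) (T B : set Y).
Variables (f : proper_pair_map S A T B) (n : nat).


Definition compact_preimage (L : compact_in T) : compact_in S :=
  exist (fun L : set X => compact L /\ L `<=` S) (S `&` f @^-1` sval L)
    (conj (@ppm_proper _ _ _ _ _ _ f _ (proj1 (svalP L)) (proj2 (svalP L)))
      (@subIsetl _ _ _)).

Fact compact_preimage_mono (L M : compact_in T) :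
  compact_le L M -> compact_le (compact_preimage L) (compact_preimage M).
Proof. by move=> LM x [Sx Lx]; split=> //; exact: LM. Qed.

Fact complement_map_space (L : compact_in T) x :
  (S `\` sval (compact_preimage L)) x -> (T `\` sval L) (f x).
Proof.
by move=> [Sx Lx]; split; [exact: pm_space|move=> Lfx; apply: Lx].
Qed.

Fact complement_map_sub (L : compact_in T) x :
  (A `\` sval (compact_preimage L)) x -> (B `\` sval L) (f x).
Proof.
move=> [Ax Lx]; split; first exact: pm_sub.
by move=> Lfx; apply: Lx; split=> //; apply: (ppm_pair f).
Qed.

Definition complement_map (L : compact_in T) :
    pair_map (S `\` sval (compact_preimage L)) (A `\` sval (compact_preimage L))
      (T `\` sval L) (B `\` sval L) :=
  @PairMap _ _ _ _ _ _ f (@complement_map_space L) (@complement_map_sub L).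

Definition complement_cohomology_map (L : compact_in T) :
    {linear complement_cohomology B n L ->
            complement_cohomology A n (compact_preimage L)} :=
  @cohomology_map _ _ _ _ _ _ (complement_map L) n.

Fact complement_cohomology_map_compat L M (h : compact_le L M)
    (x : complement_cohomology B n L) :
  restriction A n (compact_preimage_mono h) (complement_cohomology_map L x) =
  complement_cohomology_map M (restriction B n h x).
Proof.
pose M' := compact_preimage M; pose hM := compact_preimage_mono h.
have d1 t : (S `\` sval M') t -> (T `\` sval L) (f t).
  by move=> /(complement_subproof hM)/complement_map_space.
have d2 t : (A `\` sval M') t -> (B `\` sval L) (f t).
  by move=> /(complement_subproof hM)/complement_map_sub.
pose d := PairMap d1 d2.
have eL : restriction A n hM (complement_cohomology_map L x) = cohomology_map d x.
  exact: cohomology_map_comp.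
by rewrite eL; apply/esym; exact: cohomology_map_comp.
Qed.

Definition end_system_map : system_map (end_system T B n) (end_system S A n) :=
  @SystemMap R (end_system T B n) (end_system S A n) compact_preimage
    compact_preimage_mono complement_cohomology_map
    complement_cohomology_map_compat.

Definition end_cohomology_map :
    {linear end_cohomology T B n -> end_cohomology S A n} :=
  dl_map end_system_map.

End end_induced_map.
End singular_cohomology.

Section spaces.
Variable K : realType.

Definition metrizable (X : topologicalType) := exists d : X -> X -> K,
  [/\ forall x y, d x y = 0 <-> x = y, forall x y, d x y = d y x,
      forall x y z, d x z <= d x y + d y z &
      forall x (A : set X),
        nbhs x A <-> exists2 e : K, 0 < e & [set y | d x y < e] `<=` A].

Definition locally_connected (X : topologicalType) :=
  forall (x : X) (A : set X), nbhs x A ->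
    exists C : set X, [/\ open C, C x, C `<=` A & connected C].

Definition sigma_compact (X : topologicalType) :=
  exists L : nat -> set X,
    (forall i, compact (L i)) /\ \bigcup_i L i = [set: X].

Definition generalized_continuum (X : topologicalType) :=
  [/\ hausdorff_space X, connected [set: X], locally_connected X,
      sigma_compact X & locally_compact [set: X]].

Definition proper (X Y : topologicalType) (f : X -> Y) :=
  forall L : set Y, compact L -> compact (f @^-1` L).

Definition embedding (X Y : topologicalType) (f : X -> Y) :=
  [/\ continuous f, injective f &
      forall A : set X, open A -> exists2 B : set Y, open B & A = f @^-1` B].

Definition half_line : topologicalType := set_type `[(0 : K), +oo[%classic.

Record ray_space := RaySpace {
  rs_space :> topologicalType;
  rs_continuum : generalized_continuum rs_space;
  rs_metrizable : metrizable rs_space;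
  rs_ray : half_line -> rs_space;
  rs_embedding : embedding rs_ray;
  rs_proper : proper rs_ray
}.

Definition ray_image (X : ray_space) : set X := range (rs_ray X).
Arguments ray_image X : clear implicits.

Record ray_map (Y X : ray_space) := RayMap {
  rm_fun :> continuousType Y X;
  rm_proper : proper rm_fun;
  rm_ray : forall t, rm_fun (rs_ray Y t) = rs_ray X t
}.

Section ends.
Variable X : topologicalType.

Definition compact_exhaustion (L : nat -> set X) :=
  [/\ forall i, compact (L i), forall i, L i `<=` interior (L i.+1) &
      \bigcup_i L i = [set: X]].

Definition unbounded (A : set X) := ~ compact (closure A).

Definition component_of (A C : set X) :=
  exists2 x, A x & C = connected_component A x.

Definition ends (L : nat -> set X) : set (nat -> set X) :=
  [set W | forall i,
    [/\ component_of (~` L i) (W i), unbounded (W i) & W i.+1 `<=` W i]].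

End ends.

Section maps_of_pairs.

Lemma compact_ray_image_preimage (X Y : ray_space) (f : ray_map Y X)
  (L : set X) : compact L -> compact (ray_image Y `&` f @^-1` L).
Proof.
move=> cL; have -> : ray_image Y `&` f @^-1` L =
    rs_ray Y @` (rs_ray Y @^-1` (f @^-1` L)).
  apply/seteqP; split=> [_ [[t _ <-] Lt]|_ [t Lt <-]]; first by exists t.
  by split=> //; exists t.
apply: continuous_compact; last exact/rs_proper/rm_proper.
by apply: continuous_subspaceT; case: (rs_embedding Y).
Qed.

Fact ray_id_proper (X : ray_space) : proper (@idfun X). Proof. by []. Qed.

Definition ray_id (X : ray_space) : ray_map X X :=
  @RayMap X X (@idfun X) (@ray_id_proper X) (fun _ => erefl).

Variables (Y X : ray_space) (f : ray_map Y X).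

Fact ray_map_setT x : [set: Y] x -> [set: X] (f x). Proof. by []. Qed.

Fact ray_map_set0 (B : set X) x : (@set0 Y) x -> B (f x). Proof. by []. Qed.

Fact ray_map_ray x : ray_image Y x -> ray_image X (f x).
Proof. by case=> t _ <-; rewrite rm_ray; exists t. Qed.

Fact ray_map_proper L : compact L -> L `<=` [set: X] ->
  compact ([set: Y] `&` f @^-1` L).
Proof. by move=> cL _; rewrite setTI; exact: rm_proper. Qed.

(* (Y, empty) -> (X, empty) *)
Definition ray_map_abs : proper_pair_map [set: Y] set0 [set: X] set0 :=
  @ProperPairMap _ _ _ _ _ _ (PairMap ray_map_setT (@ray_map_set0 set0))
    (@sub0set _ _) ray_map_proper.

(* (Y, empty) -> (X, r) *)
Definition ray_map_absrel : proper_pair_map [set: Y] set0 [set: X] (ray_image X) :=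
  @ProperPairMap _ _ _ _ _ _ (PairMap ray_map_setT (@ray_map_set0 (ray_image X)))
    (@sub0set _ _) ray_map_proper.

(* (s, empty) -> (r, empty) *)
Definition ray_map_ends :
    proper_pair_map (ray_image Y) set0 (ray_image X) set0 :=
  @ProperPairMap _ _ _ _ _ _ (PairMap ray_map_ray (@ray_map_set0 set0))
    (@sub0set _ _) (fun L cL _ => @compact_ray_image_preimage _ _ f L cL).

(* (s, empty) -> (X, empty) *)
Definition ray_map_incl :
    proper_pair_map (ray_image Y) set0 [set: X] set0 :=
  @ProperPairMap _ _ _ _ _ _
    (@PairMap _ _ (ray_image Y) set0 [set: X] set0 f (fun _ _ => I)
      (@ray_map_set0 set0))
    (@sub0set _ _) (fun L cL _ => @compact_ray_image_preimage _ _ f L cL).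

End maps_of_pairs.
End spaces.

Arguments ray_image {K} X.

Section ray_space_cohomology.
Variables (K : realType) (R : nzRingType) (n : nat).

Definition He (X : ray_space K) : lmodType R :=
  end_cohomology K R [set: X] set0 n.

Definition He_reduced (X : ray_space K) : lmodType R :=
  end_cohomology K R [set: X] (ray_image X) n.

Definition He_ray (X : ray_space K) : lmodType R :=
  end_cohomology K R (ray_image X) set0 n.

Definition forget_ray (X : ray_space K) : {linear He_reduced X -> He X} :=
  end_cohomology_map K R (ray_map_absrel (ray_id X)) n.

Definition restrict_ray (X : ray_space K) : {linear He X -> He_ray X} :=
  end_cohomology_map K R (ray_map_incl (ray_id X)) n.

Definition He_map (Y X : ray_space K) (f : ray_map Y X) :
    {linear He X -> He Y} :=
  end_cohomology_map K R (ray_map_abs f) n.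

Definition He_ray_map (Y X : ray_space K) (f : ray_map Y X) :
    {linear He_ray X -> He_ray Y} :=
  end_cohomology_map K R (ray_map_ends f) n.

End ray_space_cohomology.

(* Main.v *)
(** In degree 0 a class of [H_e] is the germ at infinity of a function that is
    constant along paths outside a compact set.  By Mazurkiewicz's theorem a
    locally compact, locally connected metrizable space is locally path
    connected, so such a function is constant on the components of the complement
    of the compact set.  For a compact exhaustion [L], only finitely many
    components of [~` L i] are unbounded, and together they miss only a relatively
    compact set; hence a class is a function on the [i]-th level of the tree of
    unbounded components, for [i] large.  Choose a thread (an end) through every
    vertex of the tree, keeping the thread of the parent vertex whenever possible
    and starting with the end of the ray.  The indicators of the vertices at which
    a new thread had to be chosen form a basis of the reduced module: the
    functionals "value on the new thread minus value on the thread of the parent"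
    are exactly dual to them.  Adding the class of the constant 1, which also
    spans [H_e] of the ray and thereby gives the natural splitting, one gets a
    basis of [H_e].  Counting new threads counts the ends. *)
Require Import Defs.
From HB Require Import structures.
From mathcomp Require Import all_boot all_order all_algebra.
From mathcomp Require Import finmap.
From mathcomp Require Import all_classical all_reals all_analysis.
From mathcomp Require Import ring lra.

Set Implicit Arguments.
Unset Strict Implicit.
Unset Printing Implicit Defensive.

Import Order.TTheory GRing.Theory Num.Theory.
Import numFieldTopology.Exports.

Local Open Scope classical_set_scope.
Local Open Scope ring_scope.

(** * Bases of modules over a domain *)

(** Gaussian elimination on the first column, by cross multiplication instead of division; the
    nonzero pivot [p] keeps the relation nontrivial because [R] is a domain. *)
Lemma dependent_rows (R : idomainType) (n m : nat) (A : 'I_m -> 'I_n -> R) :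
  (n < m)%N ->
  exists c : 'I_m -> R, (exists i, c i != 0) /\ forall j,
    \sum_i c i * A i j = 0.
Proof.
elim: n m A => [|n IH] [//|m] A.
  by exists (fun=> 1); split=> [|[]//]; exists ord0; exact: oner_neq0.
rewrite ltnS => nm.
have [A0|] := pselect (forall i, A i ord0 = 0).
  have [c [c0 cA]] := IH m.+1 (fun i j => A i (lift ord0 j)) (ltnW nm).
  exists c; split=> // j; have [j' ->|->] := unliftP ord0 j; first exact: cA.
  by apply: big1 => i _; rewrite A0 mulr0.
move=> /existsNP[i0 /eqP p0]; set p := A i0 ord0 in p0.
pose A' (i : 'I_m) (j : 'I_n) := p * A (lift i0 i) (lift ord0 j)
  - A (lift i0 i) ord0 * A i0 (lift ord0 j).
have [c' [[i1 ci1] cA']] := IH m A' nm.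
(* The coefficient of the pivot row cancels the first column; the others are scaled by [p] to match
   [A']. *)
pose c k := oapp (fun i => p * c' i) (- \sum_i c' i * A (lift i0 i) ord0)
  (unlift i0 k).
exists c; split.
  by exists (lift i0 i1); rewrite /c liftK /= mulf_neq0.
move=> j; rewrite (bigD1_ord i0) //= {1}/c unlift_none /=.
under [X in _ + X]eq_bigr do rewrite /c liftK /=.
have [j' ->|->] := unliftP ord0 j; last first.
  rewrite -/p mulNr mulr_suml addrC -sumrB big1 // => i _.
  by ring.
rewrite -[RHS](cA' j') mulNr mulr_suml addrC -sumrB.
by apply: eq_bigr => i _; rewrite /A'; ring.
Qed.

Section bases.
Variables (R : idomainType) (M : lmodType R).

Definition span (B : set M) : set M := [set x |
  exists (n : nat) (b : 'I_n -> M) (c : 'I_n -> R),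
    (forall i, B (b i)) /\ x = \sum_(i < n) c i *: b i].

Lemma span_gen (B : set M) x : B x -> span B x.
Proof.
move=> Bx; exists 1%N, (fun=> x), (fun=> 1); split=> //.
by rewrite big_ord1 scale1r.
Qed.

Lemma span_lin (B : set M) a x y : span B x -> span B y -> span B (a *: x + y).
Proof.
move=> [n [b [c [Bb ->]]]] [n' [b' [c' [Bb' ->]]]].
exists (n + n')%N, (fun i : 'I_(n + n') =>
  match fintype.split i with inl j => b j | inr j => b' j end),
  (fun i : 'I_(n + n') => match fintype.split i with inl j =>
    a * c j | inr j => c' j end); split.
  by move=> i; case: (fintype.split i).
rewrite big_split_ord scaler_sumr /=; congr (_ + _); apply: eq_bigr => i _.
  by rewrite -[lshift _ _]/(unsplit (inl i)) unsplitK scalerA.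
by rewrite -[rshift _ _]/(unsplit (inr i)) unsplitK.
Qed.

Lemma span0 (B : set M) : span B 0.
Proof. by exists 0%N, (fun=> 0), (fun=> 0); split=> [[]//|];
  rewrite big_ord0. Qed.

Lemma span_sum (B : set M) (I : eqType) (s : seq I) (c : I -> R) (v : I -> M) :
  (forall i, i \in s -> span B (v i)) -> span B (\sum_(i <- s) c i *: v i).
Proof.
elim: s => [_|i s IH Bs]; first by rewrite big_nil; exact: span0.
rewrite big_cons; apply: span_lin; first by apply: Bs; rewrite inE eqxx.
by apply: IH => j js; apply: Bs; rewrite inE js orbT.
Qed.

Lemma span_seq (s : seq M) x :
  span [set` s] x -> exists a : 'I_(size s) -> R, x = \sum_j a j *: s`_j.
Proof.
move=> [n [b [c [sb ->]]]].
have sb' i : (index (b i) s < size s)%N by rewrite index_mem; exact: sb.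
(* An element of [s] may occur several times among the [b i], so coefficients that share a first
   position in [s] are added. *)
exists (fun j => \sum_(i < n | Ordinal (sb' i) == j) c i).
under [RHS]eq_bigr do rewrite scaler_suml.
rewrite (exchange_big_dep predT) //=; apply: eq_bigr => i _.
by rewrite (big_pred1 (Ordinal (sb' i))) /= ?nth_index //; exact: sb.
Qed.

(** Exchange bound: if [s] were longer than [t], the coefficient rows of its members over [t] would
    satisfy a nontrivial relation, and so would [s]. *)
Lemma linearly_independent_leq (B : set M) (s t : seq M) :
  linearly_independent B -> uniq s -> [set` s] `<=` B ->
  [set` s] `<=` span [set` t] -> (size s <= size t)%N.
Proof.
move=> indB us sB st; rewrite leqNgt; apply/negP => ts.
have /choice[A vA] : forall i : 'I_(size s),
    exists a : 'I_(size t) -> R, s`_i = \sum_j a j *: t`_j.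
  by move=> i; apply/span_seq/st/mem_nth.
have [c [[i ci] cA]] := dependent_rows A ts.
apply/negP: ci; rewrite negbK; apply/eqP.
apply: (indB (size s) (fun i : 'I_(size s) => s`_i)) => [j k /eqP|j|].
- by rewrite nth_uniq // => /eqP /val_inj.
- by apply: sB; exact: mem_nth.
under eq_bigr do rewrite vA scaler_sumr.
rewrite exchange_big big1 // => j _.
by under eq_bigr do rewrite scalerA; rewrite -scaler_suml cA scale0r.
Qed.

Lemma counting_finite (T : choiceType) (K : realType) (A : set T) :
  finite_set A -> counting A = (size (fset_set A))%:R%:E :> \bar K.
Proof. by move=> Afin; rewrite /counting asboolT. Qed.

Lemma counting_infinite (T : choiceType) (K : realType) (A : set T) :
  infinite_set A -> counting A = +oo%E :> \bar K.
Proof. by move=> Ainf; rewrite /counting asboolF. Qed.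

Lemma linearly_independent_finite (B C : set M) :
  linearly_independent B -> spanning C -> finite_set C ->
  finite_set B /\ (size (fset_set B) <= size (fset_set C))%N.
Proof.
move=> indB spC finC.
have Bleq (s : seq M) : uniq s -> [set` s] `<=` B ->
    (size s <= size (fset_set C))%N.
  move=> us sB; apply: linearly_independent_leq indB us sB _ => x _.
  have [n [b [c [Cb ->]]]] := spC x; exists n, b, c; split=> // i.
  by rewrite /= in_fset_set //; exact/mem_set/Cb.
have finB : finite_set B.
  apply: contrapT => /(infinite_set_fset (size (fset_set C)).+1) [F FB].
  by apply/negP; rewrite -leqNgt (Bleq F (fset_uniq F) FB).
split=> //; apply: Bleq (fset_uniq _) _ => x /=.
by rewrite in_fset_set // => /set_mem.
Qed.

Lemma counting_basis (K : realType) (B C : set M) :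
  is_basis B -> is_basis C -> counting B = counting C :> \bar K.
Proof.
move=> [indB spB] [indC spC].
have [finB|infB] := pselect (finite_set B); last first.
  rewrite !counting_infinite // => finC; apply: infB.
  by have [] := linearly_independent_finite indB spC finC.
have [finC CB] := linearly_independent_finite indC spB finB.
have [_ BC] := linearly_independent_finite indB spC finC.
by rewrite !counting_finite //; congr (_%:R%:E); apply/eqP;
  rewrite eqn_leq BC CB.
Qed.

Lemma module_rankE (K : realType) (B : set M) :
  is_basis B -> module_rank M K = counting B.
Proof.
by move=> bB; rewrite /module_rank; case: xgetP => [C _ bC|/(_ B)//];
  exact: counting_basis.
Qed.

(** Duality gives independence. For spanning, [x] minus its expansion over [s] lies in [P] and is
    killed by the functionals indexed by [s]. The finite [s] may depend on [x], which allows an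
    infinite [J]. *)
Lemma dual_basis (I : eqType) (J : set I) (v : I -> M) (lam : I -> M -> R) :
  (forall b, J b -> forall a x y, lam b (a *: x + y) = a * lam b x + lam b y) ->
  (forall b b', J b -> J b' -> lam b (v b') = (b == b')%:R) ->
  (forall x, exists (s : seq I) (P : set M),
    [/\ [set` s] `<=` J, P x, forall b, b \in s -> P (v b),
       forall a y z, P y -> P z -> P (a *: y + z) &
       forall y, P y -> (forall b, b \in s -> lam b y = 0) -> y = 0]) ->
  is_basis (v @` J) /\ {in J &, injective v}.
Proof.
move=> lamP dual gen.
have lam0 b : J b -> lam b 0 = 0.
  by move=> Jb; have := lamP b Jb (-1) 0 0; rewrite scaler0 addr0 mulN1r addNr.
have lam_sum b (I' : eqType) (r : seq I') (c : I' -> R) (w : I' -> M) : J b ->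
    lam b (\sum_(i <- r) c i *: w i) = \sum_(i <- r) c i * lam b (w i).
  move=> Jb; elim: r => [|i r IH]; first by rewrite !big_nil lam0.
  by rewrite !big_cons lamP // IH.
have vinj : {in J &, injective v}.
  move=> b b' /set_mem Jb /set_mem Jb' vbb'; have := dual b b Jb Jb.
  rewrite vbb' dual // eqxx; case: eqP => // _ /eqP.
  by rewrite eq_sym oner_eq0.
split=> //; split.
  move=> n b c b_inj Jb sum0 i; have [k Jk vk] := Jb i.
  have := lam_sum k _ (index_enum _) c b Jk; rewrite sum0 lam0 //.
  rewrite (bigD1 i) //= big1 ?addr0.
    by rewrite -vk dual // eqxx mulr1 => <-.
  move=> j ji; have [l Jl vl] := Jb j; rewrite -vl dual //.
  have [kl|_] := eqVneq k l; last by rewrite mulr0.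
  by case/eqP: ji; apply: b_inj; rewrite -vl -vk kl.
move=> x; have [s [P [sJ Px Pv Plin Pker]]] := gen x.
pose y := \sum_(b <- undup s) (- lam b x) *: v b + x.
have Py : P y.
  have : [set` undup s] `<=` [set` s] by move=> b /=; rewrite mem_undup.
  rewrite /y; elim: (undup s) => [_|b t IH ts]; first by rewrite big_nil add0r.
  rewrite big_cons -addrA; apply: Plin.
    by apply: Pv; apply: ts; rewrite /= inE eqxx.
  by apply: IH => b' /= b't; apply: ts; rewrite /= inE b't orbT.
have y0 : y = 0.
  apply: Pker => // b bs; have Jb := sJ b bs.
  rewrite /y -[X in X + _]scale1r lamP // mul1r lam_sum //.
  rewrite (bigD1_seq b) ?undup_uniq ?mem_undup //= dual // eqxx mulr1
    big_seq_cond.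
  rewrite big1 ?addr0 ?addNr // => b'; rewrite mem_undup => /andP[b's bb'].
  by rewrite (dual b b' Jb (sJ _ b's)) eq_sym (negbTE bb') mulr0.
have {y0}-> : x = \sum_(b <- undup s) lam b x *: v b.
  apply/eqP; rewrite -subr_eq0 -[X in _ == X]y0 /y addrC -sumrN.
  by under eq_bigr do rewrite -scaleNr.
apply: (@span_sum (v @` J)) => b; rewrite mem_undup => bs.
by apply: span_gen; exists b => //; exact: sJ.
Qed.

End bases.

(** Since [g u] freely generates [Q], the element [u] lifts a basis of [Q]; a basis of the kernel
    completes it. *)
Lemma split_extension_basis (R : idomainType) (M N Q : lmodType R)
    (f : {linear N -> M}) (g : {linear M -> Q}) (u : M) (B : set N) :
  injective f -> (forall y, g y = 0 <-> exists x, f x = y) ->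
  (forall a, a *: g u = 0 -> a = 0) -> (forall z, exists a, z = a *: g u) ->
  is_basis B -> is_basis (u |` f @` B) /\ ~ (f @` B) u.
Proof.
move=> f_inj exact_fg gu_free gu_gen [indB spB].
have gf x : g (f x) = 0 by apply/exact_fg; exists x.
have fBu : ~ (f @` B) u.
  move=> [x _ fxu]; have /gu_free/eqP : 1 *: g u = 0 by rewrite -fxu gf scaler0.
  by rewrite oner_eq0.
(* Membership is demanded only where the coefficient is nonzero, so a family containing [u]
   qualifies once the coefficient of [u] is known to vanish. *)
have indf n (b : 'I_n -> M) (c : 'I_n -> R) : injective b ->
    (forall i, c i != 0 -> (f @` B) (b i)) -> \sum_(i < n) c i *: b i = 0 ->
    forall i, c i = 0.
  move=> b_inj fBb sum0; apply: contrapT => /existsNP[i0 ci0].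
  pose s := [seq i <- index_enum 'I_n | c i != 0].
  have fBs i : i \in s -> (f @` B) (b i).
    by rewrite mem_filter => /andP[ci _]; exact: fBb.
  have i0s : i0 \in s by rewrite mem_filter mem_index_enum andbT; exact/eqP.
  pose k (j : 'I_(size s)) := tnth (in_tuple s) j.
  have ks j : k j \in s by rewrite /k mem_tnth.
  have /choice[b' b'P] : forall j : 'I_(size s), exists x, B x /\ f x = b (k j).
    by move=> j; have [x Bx fx] := fBs _ (ks j); exists x.
  have i0s' := i0s; rewrite -index_mem in i0s'.
  have : c (k (Ordinal i0s')) = 0.
    apply: (indB _ b' (fun j => c (k j))) => [j j' bjj'|j|].
    - have := (b'P j).2; rewrite bjj' (b'P j').2 => /b_inj /tuple_uniqP H.
      by apply/esym/H; rewrite filter_uniq ?index_enum_uniq.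
    - exact: (b'P j).1.
    apply: f_inj; rewrite linear_sum linear0.
    under eq_bigr do rewrite linearZ /= (b'P _).2.
    rewrite -(big_tuple _ _ (in_tuple s) predT (fun i => c i *: b i)) /=.
    rewrite -[RHS]sum0 big_filter big_mkcond /=; apply: eq_bigr => i _.
    by case: eqP => // ->; rewrite scale0r.
  by rewrite /k (tnth_nth i0) /= nth_index.
split=> //; split.
  move=> n b c b_inj Bb sum0.
  (* Applying [g] to the relation leaves only the term at [u], since [g] kills the image of [f]. *)
  apply: (indf n b c b_inj) => // i /eqP ci; case: (Bb i) => // bu; exfalso.
  apply/ci/gu_free; rewrite -bu -linearZ /= -[RHS](linear0 g) -sum0 linear_sum
    /=.
  rewrite (bigD1 i) //= big1 ?addr0 // => j ji; rewrite linearZ /=.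
  have [bj|[x _ <-]] := Bb j; last by rewrite gf scaler0.
  by case/eqP: ji; apply: b_inj; rewrite bj bu.
move=> x; have [a ga] := gu_gen (g x).
have /exact_fg[y fy] : g (x - a *: u) =
  0 by rewrite linearB linearZ /= ga subrr.
have [n [b [c [Bb yE]]]] := spB y.
have -> : x = a *: u + \sum_i c i *: f (b i).
  have -> : \sum_i c i *: f (b i) = f y.
    by rewrite yE linear_sum; apply: eq_bigr => i _; rewrite linearZ.
  by rewrite fy addrC subrK.
apply: (@span_lin _ _ (u |` f @` B)); first by apply: span_gen; left.
by apply: span_sum => i _; apply: span_gen; right; exists (b i).
Qed.

Lemma counting_setU1 (T : choiceType) (K : realType) (A : set T) (x : T) :
  ~ A x -> counting (x |` A) = (counting A + 1)%E :> \bar K.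
Proof.
move=> Ax; have [finA|infA] := pselect (finite_set A); last first.
  rewrite !counting_infinite //; apply: sub_infinite_set infA; exact: subsetUr.
rewrite !counting_finite //; last by rewrite finite_setU; split=> //;
  exact: finite_set1.
rewrite fset_setU1 // cardfsU1 in_fset_set // memNset // add1n.
by rewrite -natr1.
Qed.

Lemma counting_image (T T' : choiceType) (K : realType) (A : set T) (f : T ->
  T') :
  {in A &, injective f} -> counting (f @` A) = counting A :> \bar K.
Proof.
move=> f_inj; have fA := inj_card_eq f_inj.
have [finA|infA] := pselect (finite_set A); last first.
  by rewrite !counting_infinite //; rewrite (eq_finite_set fA).
rewrite !counting_finite //; last exact: finite_image.
have [n An] := (finite_setP A).1 finA.
by rewrite (card_fset_set (card_eq_trans fA An)) (card_fset_set An).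
Qed.

(** * Threads of an inverse sequence of finite sets *)

Section inverse_sequence.
Variables (T : choiceType) (U : nat -> set T) (p : nat -> T -> T).
Hypothesis U_finite : forall i, finite_set (U i).
Hypothesis p_sub : forall i C, U i.+1 C -> U i (p i C).
Hypothesis p_surj : forall i C, U i C -> exists2 D, U i.+1 D & p i D = C.

Definition threads : set (nat -> T) :=
  [set W | forall i, U i (W i) /\ p i (W i.+1) = W i].

Variable e : nat -> T.
Hypothesis e_thread : threads e.

(** [V] lists vertices from level [i] on; applying [p] repeatedly to its first vertex supplies the
    lower levels. *)
Lemma thread_prefix i (V : nat -> T) :
  (forall k, U (i + k) (V k) /\ p (i + k) (V k.+1) = V k) ->
  exists2 W, threads W & W i = V 0%N.
Proof.
elim: i V => [|i IH] V VP; first by exists V.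
have [|W EW Wi] := IH (fun k => if k is k'.+1 then V k' else p i (V 0%N)).
  case=> [|k] /=; last by rewrite addnS -addSn; exact: VP.
  by rewrite addn0; split=> //; apply: p_sub; have := (VP 0%N).1; rewrite addn0.
(* The thread obtained for level [i] forgets [V 0], so it is spliced with [V]. *)
exists (fun k => if (k <= i)%N then W k else V (k - i.+1)%N); last first.
  by rewrite ltnn subnn.
move=> k; case: ltngtP => [ki|ik|->].
- exact: EW.
- by have := VP (k - i.+1)%N; rewrite subnKC // -subSn // subSS.
- rewrite subnn Wi; split=> //; rewrite -Wi; exact: (EW i).1.
Qed.

(** Surjectivity of [p] and choice give an infinite ascent from [C]; [thread_prefix] adds the levels
    below. *)
Lemma thread_through i C : U i C -> exists2 W, threads W & W i = C.
Proof.
move=> UC; have /choice[s sP] : forall q : nat * T, exists D,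
    U q.1 q.2 -> U q.1.+1 D /\ p q.1 D = q.2.
  move=> [j D]; have [/p_surj[D' UD' pD']|UD] := pselect (U j D).
    by exists D'.
  by exists D => /UD.
pose V := fix V k := if k is k'.+1 then s ((i + k')%N, V k') else C.
have UV k : U (i + k) (V k).
  elim: k => [|k IH] /=; first by rewrite addn0.
  by rewrite addnS; exact: (sP (_, _) IH).1.
have [|W EW WC] := @thread_prefix i V; last by exists W.
by move=> k; split=> //; exact: (sP (_, _) (UV k)).2.
Qed.

Definition new_thread i C := xget e [set W | threads W /\ W i = C].

(* The parent's thread is reused whenever it passes through [C]; the [branching]
   vertices below, those where a new thread starts, index the basis. *)
Fixpoint thread_of i C : nat -> T :=
  let P := if i is j.+1 then thread_of j (p j C) else e in
  if P i == C then P else new_thread i C.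

Definition parent_thread i C : nat -> T :=
  if i is j.+1 then thread_of j (p j C) else e.

Definition branching : set (nat * T) :=
  [set b | U b.1 b.2 /\ parent_thread b.1 b.2 b.1 <> b.2].

Lemma thread_ofE i C : thread_of i C =
  if parent_thread i C i == C then parent_thread i C else new_thread i C.
Proof. by case: i. Qed.

Lemma thread_ofP i C : U i C -> threads (thread_of i C) /\ thread_of i C i = C.
Proof.
elim: i C => [|i IH] C UC; rewrite thread_ofE; case: eqP => [PC|_].
- by [].
- have [W EW WC] := thread_through UC.
  by rewrite /new_thread; case: xgetP => [//|/(_ W)/not_andP[]].
- by split=> //; exact: (IH _ (p_sub UC)).1.
- have [W EW WC] := thread_through UC.
  by rewrite /new_thread; case: xgetP => [//|/(_ W)/not_andP[]].
Qed.

Lemma parent_threadP i C : U i C -> threads (parent_thread i C).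
Proof. by case: i => [//|i] /p_sub /thread_ofP[]. Qed.

Lemma threads_eq_below V W i j : threads V -> threads W -> V i = W i ->
  (j <= i)%N -> V j = W j.
Proof.
move=> EV EW; elim: i => [|i IH] VWi; first by rewrite leqn0 => /eqP ->.
rewrite leq_eqVlt => /predU1P[-> //|]; rewrite ltnS; apply: IH.
by rewrite -(EV i).2 -(EW i).2 VWi.
Qed.

(** A thread selected at one of its vertices is inherited at every later one, because it already
    passes through it. *)
Lemma thread_of_self W i : threads W -> thread_of i (W i) = W ->
  forall k, (i <= k)%N -> thread_of k (W k) = W.
Proof.
move=> EW Wi; elim=> [|k IH]; first by rewrite leqn0 => /eqP <-.
rewrite leq_eqVlt => /predU1P[<- //|]; rewrite ltnS => /IH {}IH.
by rewrite thread_ofE /= (EW k).2 IH eqxx.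
Qed.

(** By inheritance the parent of [W j] carries [W] itself, which passes through [W j]; no new thread
    starts there. *)
Lemma branching_not_later W i j D : threads W -> thread_of i (W i) = W ->
  (i < j)%N -> branching (j, D) -> W j <> D.
Proof.
case: j => // j EW Wi; rewrite ltnS => ij [/= UD PD] WD; apply: PD.
by rewrite -{1}WD (EW j).2 (thread_of_self EW Wi).
Qed.

Lemma thread_of_fixed i C : U i C ->
  thread_of i (thread_of i C i) = thread_of i C.
Proof. by move=> UC; rewrite (thread_ofP UC).2. Qed.

Lemma branching_dual (R : nzRingType) (b c : nat * T) :
  branching b -> branching c ->
  (thread_of b.1 b.2 c.1 == c.2)%:R - (parent_thread b.1 b.2 c.1 == c.2)%:R =
  (b == c)%:R :> R.
Proof.
case: b c => [i C] [j D] /= Bb Bc; have [UC PC] := Bb; have [UD PD] := Bc.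
rewrite /= in UC PC UD PD.
have [EW WC] := thread_ofP UC; have EP := parent_threadP UC.
have [ij|ji|ij] := ltngtP i j.
(* Both threads were selected at a level below [j], so they miss every branching vertex of level
   [j]. *)
- have -> : (thread_of i C j == D) = false.
    by apply/eqP; apply: (branching_not_later EW _ ij) => //;
      exact: thread_of_fixed.
  have -> : (parent_thread i C j == D) = false.
    apply/eqP; case: i {Bb PC WC EW} UC EP ij => [|i] /= UC EP ij.
      apply: (branching_not_later e_thread _ ij) => //.
      by rewrite thread_ofE /= eqxx.
    apply: (branching_not_later EP _ (ltnW ij)) => //.
    exact/thread_of_fixed/p_sub.
  by rewrite subrr; case: eqP => // -[ij']; rewrite ij' ltnn in ij.
(* Both threads pass through the parent of [C], hence agree at all levels below [i]. *)
- have -> : thread_of i C j = parent_thread i C j.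
    case: i {Bb} UC PC EW WC EP ji => [//|i] UC PC EW WC EP; rewrite ltnS.
    apply: (threads_eq_below EW EP).
    by rewrite [RHS](thread_ofP (p_sub UC)).2 -(EW i).2 WC.
  by rewrite subrr; case: eqP => // -[ij']; rewrite ij' ltnn in ji.
- subst j; rewrite WC xpair_eqE eqxx /=.
  have [CD|_] := eqVneq C D; last first.
    have -> : (parent_thread i C i == D) = false; last by rewrite subrr.
    (* If the parent's thread passed through [D], then [C] and [D] would have the same parent, and
       [D] would inherit that thread instead of branching. *)
    apply/eqP => PCD; apply: PD; rewrite -[RHS]PCD.
    case: i UC PC PCD EP {Bb Bc UD EW WC} => [//|i] UC PC PCD EP /=.
    by rewrite -PCD (EP i).2 /= (thread_ofP (p_sub UC)).2.
  by have /eqP/negbTE -> : parent_thread i C i <> D;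
    [rewrite -CD|rewrite subr0].
Qed.

(** Every vertex of [e] inherits [e], so branching happens off [e]. This makes the indicator of a
    branching component vanish along the ray near infinity. *)
Lemma branching_neq i C : branching (i, C) -> C <> e i.
Proof.
move=> [/= _ PC] Ce; apply: PC; rewrite Ce.
case: i {Ce} => //= i; rewrite (e_thread i).2.
suff -> : thread_of i (e i) = e by [].
by apply: (thread_of_self e_thread _ (leq0n i)); rewrite thread_ofE /= eqxx.
Qed.

(** The value 0 at [e] propagates up the tree: at a branching vertex the hypothesis equates the new
    thread with the parent's one, elsewhere the thread is inherited. *)
Lemma branching_kernel (R : nzRingType) (phi : (nat -> T) -> R) i :
  phi e = 0 ->
  (forall b, branching b -> (b.1 <= i)%N ->
     phi (thread_of b.1 b.2) = phi (parent_thread b.1 b.2)) ->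
  forall k C, (k <= i)%N -> U k C -> phi (thread_of k C) = 0.
Proof.
move=> phi0 phiB; have step k C : (k <= i)%N -> U k C ->
  phi (parent_thread k C) = 0 ->
    phi (thread_of k C) = 0.
  move=> ki UC P0; have [PC|/eqP PC] := eqVneq (parent_thread k C k) C.
    by rewrite thread_ofE PC eqxx.
  by have /= -> := phiB (k, C) (conj UC PC) ki.
elim=> [|k IH] C ki UC; first exact: step.
by apply: step => //; apply: IH; [exact: ltnW|exact: p_sub].
Qed.

Lemma branching_finite_level i : finite_set [set b | branching b /\
  (b.1 <= i)%N].
Proof.
apply: (@sub_finite_set _ _ (\bigcup_(k in `I_i.+1) (pair k @` U k))).
  by move=> [k C] [[UC _] ki]; exists k => //; exists C.
by apply: bigcup_finite => [|k _]; [exact: finite_II|exact: finite_image].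
Qed.

Lemma branching_countable : countable branching.
Proof.
have -> : branching = \bigcup_i [set b | branching b /\ (b.1 <= i)%N].
  by apply/seteqP; split=> [b Bb|b [i _ []//]]; exists b.1.
apply: bigcup_countable => // i _.
exact/finite_set_countable/branching_finite_level.
Qed.

(** [thread_of] embeds the branching vertices into the threads other than [e]. If they are finite in
    number, every thread is inherited from some level on and so arises this way; otherwise both
    counts are infinite. *)
Lemma counting_threads (K : realType) :
  counting threads = (counting branching + 1)%E :> \bar K.
Proof.
pose t (b : nat * T) := thread_of b.1 b.2.
have t_inj : {in branching &, injective t}.
  move=> [i C] [j D] /set_mem Bb /set_mem Bc tbc.
  wlog ij : i j C D Bb Bc tbc / (i <= j)%N.
    by move=> wl; have [/wl|/ltnW/wl] := leqP i j; [exact|move=> H;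
      apply/esym/H].
  have [UC PC] := Bb; have [UD PD] := Bc.
  have [EW WC] := thread_ofP UC; have [EV VD] := thread_ofP UD.
  rewrite /t /= in WC VD tbc; move: ij; rewrite leq_eqVlt => /predU1P[ij|ij].
    by subst j; rewrite -WC -VD tbc.
  have := branching_not_later EW (thread_of_fixed UC) ij Bc.
  by rewrite /= tbc VD.
(* A thread started at a branching vertex passes through it, whereas [e] meets none. *)
have et : ~ (t @` branching) e.
  move=> [[i C] Bb te]; have [UC PC] := Bb; have [EW WC] := thread_ofP UC.
  rewrite /t /= in te WC; have Ce : e i = C by rewrite -te.
  case: i Bb UC PC te EW WC Ce => [//|i] Bb UC PC te EW WC Ce.
  apply: (@branching_not_later e 0 i.+1 C) => //.
  by rewrite thread_ofE /= eqxx.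
rewrite -(counting_image _ t_inj) -(counting_setU1 _ et).
have sub : e |` t @` branching `<=` threads.
  by move=> _ [->//|[b [Ub _] <-]]; exact: (thread_ofP Ub).1.
have [finB|infB] := pselect (finite_set branching); last first.
  rewrite !counting_infinite // => [fin|/(sub_finite_set sub) fin]; apply: infB.
    have /(sub_finite_set (@subsetUr _ _ _)) := fin.
    by rewrite (eq_finite_set (inj_card_eq t_inj)).
  have /(sub_finite_set (@subsetUr _ _ _)) := fin.
  by rewrite (eq_finite_set (inj_card_eq t_inj)).
congr counting; apply/seteqP; split=> // W EW.
have tB k C : U k C -> (e |` t @` branching) (thread_of k C).
  elim: k C => [|k IH] C UC; rewrite thread_ofE; case: eqP => PC.
  - by left.
  - right; exists (0%N, C) => //; rewrite /t thread_ofE.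
    by move/eqP/negbTE: PC => ->.
  - exact/IH/p_sub.
  - right; exists (k.+1, C) => //; rewrite /t thread_ofE.
    by move/eqP/negbTE: PC => ->.
(* From level [N] on no vertex branches, so [W] follows the thread selected at [W N]. *)
have [N NB] : exists N, forall b, branching b -> (b.1 < N)%N.
  have [s sB] := (finite_seqP _).1 finB; exists (\max_(b <- s) b.1).+1 => b.
  by rewrite ltnS sB => bs; exact: (leq_bigmax_seq b).
have WN k : (N <= k)%N -> thread_of k (W k) = thread_of N (W N).
  elim: k => [|k IH]; first by rewrite leqn0 => /eqP <-.
  rewrite leq_eqVlt => /predU1P[<- //|]; rewrite ltnS => Nk.
  rewrite thread_ofE /= (EW k).2 IH //; case: eqP => // PW.
  have /NB /= : branching (k.+1, W k.+1).
    by split=> /=; [exact: (EW _).1|rewrite (EW k).2 IH].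
  by rewrite ltnNge ltnW.
suff -> : W = thread_of N (W N) by apply: tB; exact: (EW N).1.
apply/funext => k; have [EV VN] := thread_ofP (EW N).1.
have [Nk|kN] := leqP N k.
  by rewrite -(WN k Nk) (thread_ofP (EW k).1).2.
by apply: (threads_eq_below EW EV _ (ltnW kN)); rewrite VN.
Qed.

End inverse_sequence.

(** * Classes in degree 0 as germs of functions *)

Section singular_points.
Variable K : realType.

Fact vertex0_subproof : const_mx 1 \in @simplex_set K 0.
Proof.
by apply/mem_set; split=> [i|]; rewrite ?big_ord1 mxE.
Qed.

Definition vertex0 : simplex K 0 :=
  exist (fun u => u \in @simplex_set K 0) _ vertex0_subproof.

Lemma simplex0E (t : simplex K 0) : t = vertex0.
Proof.
apply: val_inj; case: t => t /= /set_mem[_]; rewrite big_ord1 => t1.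
by apply/rowP => i; rewrite ord1 t1 mxE.
Qed.

Variables (X : topologicalType) (U : set X).

Fact point_simplex_subproof x : U x ->
  range (cst x : continuousType (simplex K 0) X) `<=` U.
Proof. by move=> Ux _ [t _ <-]. Qed.

Definition point_simplex x (Ux : U x) : singular_simplex K U 0 :=
  exist (fun s : continuousType (simplex K 0) X => range s `<=` U) _
    (point_simplex_subproof Ux).

Lemma singular_simplex0P (s : singular_simplex K U 0) : U (sval s vertex0).
Proof. by apply: (svalP s); exists vertex0. Qed.

Lemma point_simplexE (s : singular_simplex K U 0) :
  s = point_simplex (singular_simplex0P s).
Proof.
case: s => s sU; apply/eq_exist/continuousEP => t /=.
by rewrite (simplex0E t).
Qed.

(* The two faces of a singular 1-simplex are its end points. *)
Definition path_constant (T : Type) (f : X -> T) :=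
  forall s : singular_simplex K U 1,
    f (sval s (face ord0 vertex0)) = f (sval s (face (lift ord0 ord0) vertex0)).

Variables (R : nzRingType) (A : set X).

Definition value_cochain (f : X -> R) : cochain K R U 0 :=
  fun s => f (sval s vertex0).

(** The end points of a path enter the coboundary with opposite signs, so being closed means taking
    equal values at both ends of every path. *)
Lemma value_cochain_cocycleP (f : X -> R) :
  value_cochain f \in is_cocycle A (n := 0) <->
  path_constant f /\ {in U `&` A, forall x, f x = 0}.
Proof.
have bE s : coboundary (value_cochain f) s =
    f (sval s (face ord0 vertex0)) - f (sval s (face (lift ord0 ord0) vertex0)).
  rewrite /coboundary !big_ord_recl big_ord0 addr0 /= expr0 mul1r.
  by rewrite expr1 mulN1r.
split=> [/asboolP[frel fcob]|[fpath fA]].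
  split=> [s|x /set_mem[Ux Ax]].
    by apply/eqP; rewrite -subr_eq0 -bE fcob.
  by apply: (frel (point_simplex Ux)) => _ [t _ <-].
apply/asboolP; split=> [s sA|].
  apply: fA; apply/mem_set; split; first exact: singular_simplex0P.
  by apply: sA; exists vertex0.
by apply/funext => s; rewrite bE fpath subrr.
Qed.

End singular_points.

Section germs_at_infinity.
Variables (K : realType) (R : nzRingType) (X : topologicalType) (S A : set X).
Local Notation H := (end_cohomology K R S A 0).

Definition end_class (L : compact_in S)
    (c : cocycle K R (S `\` sval L) (A `\` sval L) 0) : H :=
  dl_inj (D := end_system K R S A 0) (i := L)
    (qproj (@is_coboundary K R X (S `\` sval L) (A `\` sval L) 0) c).

(** In degree 0 the zero cochain is the only coboundary. *)
Lemma cocycle_subP (U B : set X) (c d : cocycle K R U B 0) :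
  c - d \in @is_coboundary K R X U B 0 <-> cocycle_val c =1 cocycle_val d.
Proof.
have valB : cocycle_val (c - d) =
  (cocycle_val c : cochain K R U 0) - cocycle_val d.
  exact: (linearB (@cocycle_val K R X U B 0 : {linear _ -> _})).
split=> [/asboolP + s|cd]; last by apply/asboolP; rewrite valB; apply/eqP;
  rewrite subr_eq0; apply/eqP/funext.
rewrite valB => /(congr1 (fun u : cochain K R U 0 => u s)) /eqP.
by rewrite subr_eq0 => /eqP.
Qed.

(** [f] is total on [X], though only its values outside a compactum matter; plain functions thus
    replace cochains on varying subspaces. *)
Definition represents (x : H) (f : X -> R) :=
  exists (L : compact_in S) (c : cocycle K R (S `\` sval L) (A `\` sval L) 0),
    x = end_class c /\ cocycle_val c =1 value_cochain f.

Lemma represents_exists (x : H) : exists f, represents x f.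
Proof.
have [L [y ->]] := dl_injW x; rewrite -[y]qproj_repr; set c := repr y.
(* The value 0 off the subspace is a mere filler. *)
exists (fun z => if pselect ((S `\` sval L) z) is left Sz
  then cocycle_val c (point_simplex K Sz) else 0).
exists L, c; split=> // s; rewrite /value_cochain; case: pselect => [Sz|].
  by rewrite {1}(point_simplexE s); congr (cocycle_val c _); exact: eq_exist.
by case; exact: singular_simplex0P.
Qed.

Lemma represents_cocycle (x : H) f : represents x f ->
  exists L : compact_in S, path_constant K (S `\` sval L) f /\
    forall z, A z -> (S `\` sval L) z -> f z = 0.
Proof.
move=> [L [c [_ /funext cf]]]; exists L.
have [|fpath fA] := (@value_cochain_cocycleP K X (S `\` sval L) R (A `\` sval
  L) f).1.
  by rewrite -cf; exact: cocycleP.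
by split=> // z Az [Sz Lz]; apply: fA; apply/mem_set.
Qed.

Lemma represents_intro (L : compact_in S) (f : X -> R) :
  path_constant K (S `\` sval L) f ->
  (forall z, A z -> (S `\` sval L) z -> f z = 0) -> exists x, represents x f.
Proof.
move=> fpath fA.
have /(@value_cochain_cocycleP K X _ R (A `\` sval L) f) cf :
    path_constant K (S `\` sval L) f /\
    {in (S `\` sval L) `&` (A `\` sval L), forall z, f z = 0}.
  by split=> // z /set_mem[SLz [Az _]]; exact: fA.
by exists (end_class (Cocycle cf)), L, (Cocycle cf).
Qed.

Lemma represents_eq (x y : H) f g : represents x f -> represents y g ->
  x = y <-> exists L : compact_in S, forall z, (S `\` sval L) z -> f z = g z.
Proof.
move=> [L [c [-> cf]]] [M [d [-> dg]]]; split.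
  move=> /dl_injP[N [h [h' e]]]; exists N => z Sz.
  move: e; rewrite /= /restriction.
  rewrite (cohomology_mapE (complement_inclusion A h)).
  rewrite (cohomology_mapE (complement_inclusion A h')) =>
    /qprojP /cocycle_subP.
  by move=> /(_ (point_simplex K Sz)); rewrite /= cf dg.
move=> [N0 fg]; have [N1 [LN1 MN1]] := compact_le_directed L M.
have [N [N0N N1N]] := compact_le_directed N0 N1.
have h := compact_le_trans LN1 N1N; have h' := compact_le_trans MN1 N1N.
apply/dl_injP; exists N, h, h'; rewrite /= /restriction.
rewrite (cohomology_mapE (complement_inclusion A h)).
rewrite (cohomology_mapE (complement_inclusion A h')).
apply/qprojP/cocycle_subP => s; rewrite /= cf dg; apply: fg.
by have [Ss Ns] := singular_simplex0P s; split=> // /N0N.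
Qed.

Lemma represents_linear (x y : H) f g a : represents x f -> represents y g ->
  represents (a *: x + y) (fun z => a * f z + g z).
Proof.
move=> [L [c [-> cf]]] [M [d [-> dg]]].
have [N [h h']] := compact_le_directed L M.
have cN := dl_inj_map (D := end_system K R S A 0) (h : ds_le (d :=
  end_system K R S A 0) L N)
  (qproj (@is_coboundary K R X (S `\` sval L) (A `\` sval L) 0) c).
have dN := dl_inj_map (D := end_system K R S A 0) (h' : ds_le (d :=
  end_system K R S A 0) M N)
  (qproj (@is_coboundary K R X (S `\` sval M) (A `\` sval M) 0) d).
rewrite /= /restriction (cohomology_mapE (complement_inclusion A h)) in cN.
rewrite /= /restriction (cohomology_mapE (complement_inclusion A h')) in dN.
exists N, (a *: cocycle_map (complement_inclusion A h) c
  + cocycle_map (complement_inclusion A h') d); split.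
  by rewrite /end_class -cN -dN -linearP -linearP.
move=> s; have vE := cocycle_val_linear a
  (cocycle_map (complement_inclusion A h) c) (cocycle_map (complement_inclusion
    A h') d).
rewrite vE -[LHS]/(a * cocycle_val (cocycle_map (complement_inclusion A h) c) s
   + cocycle_val (cocycle_map (complement_inclusion A h') d) s) /= cf dg.
by [].
Qed.

End germs_at_infinity.

(** A cocycle outside [L] pulls back to one outside the preimage of [L], which is compact by
    properness. *)
Lemma represents_map (K : realType) (R : nzRingType) (X Y : topologicalType)
    (S A : set X) (T B : set Y) (F : proper_pair_map S A T B)
    (x : end_cohomology K R T B 0) (f : Y -> R) :
  represents x f -> represents (end_cohomology_map K R F 0 x) (f \o F).
Proof.
move=> [L [c [-> cf]]]; exists (compact_preimage F L),
  (cocycle_map (complement_map F L) c).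
split; last by move=> s; rewrite /= cf.
rewrite /end_cohomology_map /end_class /= dl_mapE /=.
rewrite /complement_cohomology_map.
by rewrite (cohomology_mapE (complement_map F L)).
Qed.

(** * Paths in locally connected metric spaces *)

(** The sets whose complement in [L] satisfies [P] form a filter. If [P L] failed, it would be
    proper and cluster at a point of [L], against the local hypothesis. *)
Lemma compact_union_ind (X : topologicalType) (L : set X) (P : set X -> Prop) :
  compact L -> P set0 -> (forall A B, A `<=` B -> P B -> P A) ->
  (forall A B, P A -> P B -> P (A `|` B)) ->
  (forall x, L x -> exists2 V, nbhs x V & P V) -> P L.
Proof.
move=> cL P0 Psub PU Ploc.
pose F : set_system X := [set A | P (L `\` A)].
have FF : Filter F.
  split.
  - by rewrite /F /= setDT.
  - by move=> A B FA FB; rewrite /F /= setDIr; exact: PU.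
  - by move=> A B AB; apply: Psub => x [Lx Bx]; split=> // /AB.
apply: contrapT => nPL.
have PF : ProperFilter F by split=> //; rewrite /F /= setD0.
have FL : F L by rewrite /F /= setDv.
have [x [Lx xF]] := cL F PF FL.
have [V xV PV] := Ploc x Lx.
have FV : F (~` V) by apply: Psub PV => y [_ /contrapT].
by have [y [Vy]] := xF _ _ FV xV.
Qed.

Lemma half_expr_small (K : realType) (e : K) : 0 < e -> exists k, 2^-1 ^+ k < e.
Proof.
move=> e0; exists (Num.Def.archi_bound e^-1).
have := upper_nthrootP (leqnn (Num.Def.archi_bound e^-1)) => H.
by rewrite exprVn invf_plt ?posrE ?exprn_gt0.
Qed.

(** Used to read off the position of a parameter in a coarse chain from its position in a refinement
    by the factor [n]. *)
Lemma truncn_div (K : realType) (x : K) (n : nat) : 0 <= x -> (0 < n)%N ->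
  (Num.truncn (x * n%:R) %/ n)%N = Num.truncn x.
Proof.
move=> x0 n0; have n0' : (0 : K) < n%:R by rewrite ltr0n.
apply/esym/truncn_def; have /truncn_itv/andP[l u] : 0 <= x * n%:R.
  by rewrite mulr_ge0 // ltW.
set m := Num.truncn _ in l u *.
apply/andP; split.
  rewrite -(ler_pM2r n0') -natrM; apply: le_trans l.
  by rewrite ler_nat leq_divM.
rewrite -(ltr_pM2r n0') -natrM; apply: lt_le_trans u _.
by rewrite ler_nat ltn_ceil.
Qed.

Section metric_paths.
Variables (K : realType) (X : topologicalType) (d : X -> X -> K).
Hypothesis d0 : forall x y, d x y = 0 <-> x = y.
Hypothesis dC : forall x y, d x y = d y x.
Hypothesis dtri : forall x y z, d x z <= d x y + d y z.
Hypothesis dnbhs : forall x (A : set X),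
  nbhs x A <-> exists2 e : K, 0 < e & [set y | d x y < e] `<=` A.
Hypothesis lcX : locally_connected X.

Let d_refl x : d x x = 0. Proof. exact/d0. Qed.

Let d_ge0 x y : 0 <= d x y.
Proof. by have := dtri x y x; rewrite d_refl (dC y x); lra. Qed.

Definition small (W : set X) (e : K) := forall x y, W x -> W y -> d x y < e.

Lemma small_connected_nbhs (V : set X) x (e : K) : open V -> V x -> 0 < e ->
  exists W, [/\ open W, connected W, W x, W `<=` V & small W e].
Proof.
move=> oV Vx e0.
have [W [oW Wx WV cW]] : exists C : set X, [/\ open C, C x,
    C `<=` V `&` [set y | d x y < e / 2] & connected C].
  apply: lcX; apply: filterI; first exact: open_nbhs_nbhs.
  by apply/dnbhs; exists (e / 2) => //; rewrite divr_gt0.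
exists W; split=> // [y /WV[]//|y z /WV[_ /= xy] /WV[_ /= xz]].
by have := dtri y x z; rewrite (dC y x); lra.
Qed.

(** Link [W m] joins [q m] to [q m.+1]. *)
Definition is_chain (V : set X) (e : K) (n : nat) (q : nat -> X)
    (W : nat -> set X) :=
  forall m, (m < n)%N -> [/\ open (W m), connected (W m), W m `<=` V &
    [/\ small (W m) e, W m (q m) & W m (q m.+1)]].

Definition chained V e n a b :=
  exists q W, [/\ is_chain V e n q W, q 0%N = a & q n = b].

Lemma chained_snoc V e n a b c W : chained V e n a b ->
  open W -> connected W -> W `<=` V -> small W e -> W b -> W c ->
  chained V e n.+1 a c.
Proof.
move=> [q [Wq [qP q0 qn]]] oW cW WV sW Wb Wc.
exists (fun m => if (m <= n)%N then q m else c), (fun m =>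
  if (m < n)%N then Wq m else W).
split=> [m||]; last 2 first.
- by [].
- by rewrite ltnn.
rewrite ltnS => /[dup] mn; rewrite {1}leq_eqVlt => /predU1P[->|mn'].
  by rewrite leqnn ltnn qn.
by rewrite mn mn'; exact: qP.
Qed.

(** The points reached from [a] form a nonempty clopen part of [V]. Repeating [b] lengthens a chain,
    so all large lengths occur; this allows a common length for several chains. *)
Lemma chained_connected V (e : K) a b : open V -> connected V -> 0 < e ->
  V a -> V b ->
  exists n0, forall n, (n0 <= n)%N -> chained V e n a b.
Proof.
move=> oV cV e0 Va Vb.
pose A := [set x | V x /\ exists n, chained V e n a x].
have step x y W : A x -> open W -> connected W -> W `<=` V -> small W e ->
    W x -> W y -> A y.
  move=> [Vx [n xn]] oW cW WV sW Wx Wy; split; first exact: WV.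
  by exists n.+1; exact: chained_snoc xn oW cW WV sW Wx Wy.
have AV : A `<=` V by move=> x [].
have oA : open A.
  rewrite openE => x Ax; have [W [oW cW Wx WV sW]] :=
    small_connected_nbhs oV (AV _ Ax) e0.
  by apply: (filterS _ (open_nbhs_nbhs (conj oW Wx))) => y Wy;
    exact: (step x y W).
have oVA : open (V `\` A).
  rewrite openE => x [Vx Ax];
    have [W [oW cW Wx WV sW]] := small_connected_nbhs oV Vx e0.
  apply: (filterS _ (open_nbhs_nbhs (conj oW Wx))) => y Wy; split;
    first exact: WV.
  by move=> Ay; apply: Ax; exact: (step y x W).
have [_ [n0 an0]] : A b.
  suff AVe : A = V by rewrite AVe.
  apply/cV.
  - by exists a; split=> //; exists 0%N, (fun=> a), (fun=> V).
  - by exists A => //; rewrite setIidr.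
  - exists (~` (V `\` A)); first exact: open_closedC.
    apply/seteqP; split=> [x Ax|x [Vx]]; last by move=> /not_andP[//|/contrapT].
    by split; [exact: AV|move=> []].
exists n0 => n; elim: n => [|n IH]; first by rewrite leqn0 => /eqP <-.
rewrite leq_eqVlt => /predU1P[<- //|]; rewrite ltnS => /IH an.
have [W [oW cW Wb WV sW]] := small_connected_nbhs oV Vb e0.
exact: (chained_snoc an oW cW WV sW Wb Wb).
Qed.

(** All links are subdivided into the same number [n] of smaller ones, so positions in the two
    chains are related by division by [n]. *)
Lemma chain_refinement V (e e' : K) N q W : is_chain V e N q W -> 0 < e' ->
  exists n q' W', [/\ (0 < n)%N, is_chain V e' (N * n) q' W',
    forall m, (m < N * n)%N -> W' m `<=` W (m %/ n)%N &
    q' 0%N = q 0%N /\ q' (N * n)%N = q N].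
Proof.
move=> qW e'0.
have /choice[n0 n0P] : forall j, exists n0, (j < N)%N ->
    forall n, (n0 <= n)%N -> chained (W j) e' n (q j) (q j.+1).
  move=> j; have [jN|] := boolP (j < N)%N; last by exists 0%N.
  have [oW cW _ [_ Wj Wj1]] := qW j jN.
  by have [n0 n0P] := chained_connected oW cW e'0 Wj Wj1; exists n0.
pose n := (\max_(j < N) n0 j).+1.
have /choice[Q QP] : forall j, exists Q : (nat -> X) * (nat -> set X),
    (j < N)%N -> [/\ is_chain (W j) e' n Q.1 Q.2,
      Q.1 0%N = q j & Q.1 n = q j.+1].
  move=> j; have [jN|] := boolP (j < N)%N; last by exists (q, W).
  have [|Q [W' QW]] := n0P j jN n; last by exists (Q, W').
  by rewrite leqW // (leq_bigmax (Ordinal jN)).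
exists n, (fun m => if (m < N * n)%N then (Q (m %/ n)%N).1 (m %% n)%N else q N),
  (fun m => (Q (m %/ n)%N).2 (m %% n)%N).
have divN m : (m < N * n)%N -> (m %/ n < N)%N by move=> mN; rewrite ltn_divLR.
have key m : (m < N * n)%N -> [/\ open ((Q (m %/ n)%N).2 (m %% n)%N),
    connected ((Q (m %/ n)%N).2 (m %% n)%N),
    (Q (m %/ n)%N).2 (m %% n)%N `<=` W (m %/ n)%N &
    [/\ small ((Q (m %/ n)%N).2 (m %% n)%N) e',
     (Q (m %/ n)%N).2 (m %% n)%N ((Q (m %/ n)%N).1 (m %% n)%N) &
     (Q (m %/ n)%N).2 (m %% n)%N ((Q (m %/ n)%N).1 (m %% n).+1)]].
  by move=> /divN mN; have [+ _ _] := QP _ mN; apply; rewrite ltn_mod.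
split=> //.
- move=> m mN; have [oW cW WW [sW W1 W2]] := key m mN.
  rewrite mN; split=> //; first by apply: subset_trans WW _;
    have [] := qW _ (divN _ mN).
  split=> //.
  have [mn|mn] := ltnP (m %% n).+1 n.
    have m1 : m.+1 = (m %/ n * n + (m %% n).+1)%N by rewrite addnS -divn_eq.
    have -> : (m.+1 %/ n)%N = (m %/ n)%N.
      by rewrite m1 divnMDl // (divn_small mn) addn0.
    have -> : (m.+1 %% n)%N = (m %% n).+1 by rewrite m1 modnMDl modn_small.
    suff -> : (m.+1 < N * n)%N by [].
    rewrite m1; apply: leq_trans (leq_mul (divN _ mN) (leqnn n)).
    by rewrite mulSn addnC ltn_add2r.
  (* The last small link inside a coarse link ends where the next coarse link begins, or at
     [q N]. *)
  have mn' : (m %% n).+1 = n by apply/eqP; rewrite eqn_leq mn ltn_mod.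
  have m1 : m.+1 = ((m %/ n).+1 * n)%N.
    by rewrite {1}(divn_eq m n) -addnS mn' mulSn addnC.
  rewrite mn' in W2; rewrite m1 mulnK // modnMl ltn_mul2r /=.
  have [_ _ Qn] := QP _ (divN _ mN); rewrite Qn in W2.
  case: ltnP => [/QP[_ -> _]//|Nm].
  by rewrite (_ : N = (m %/ n).+1) //; apply/eqP; rewrite eqn_leq Nm divN.
- by move=> m /key[].
split; last by rewrite ltnn.
case: ltnP => [|]; first by move=> /divN; rewrite div0n mod0n => /QP[].
by rewrite leqn0 muln_eq0 orbF => /eqP ->.
Qed.

(* Mazurkiewicz: successively refined chains give step functions on [0, 1] that
   converge uniformly to a path. *)
Lemma path_in_connected (V L : set X) a b : open V -> connected V -> V `<=` L ->
  compact L -> V a -> V b ->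
  exists g : K -> X, [/\ g 0 = a, g 1 = b, forall t : K,
    0 <= t <= 1 -> L (g t) &
    forall t e : K, 0 <= t <= 1 -> 0 < e -> exists2 r : K, 0 < r &
      forall t' : K, 0 <= t' <= 1 -> `|t - t'| < r -> d (g t) (g t') < e].
Proof.
move=> oV cV VL cL Va Vb.
pose eps k : K := 2^-1 ^+ k.
have eps0 k : 0 < eps k by rewrite exprn_gt0.
have epsS k : eps k = 2 * eps k.+1 by rewrite /eps exprS mulrA divff ?mul1r.
(* A state is a stage [k] with the number of links, the points and the links of a chain from [a] to
   [b]. *)
pose S := (nat * (nat * (nat -> X) * (nat -> set X)))%type.
pose good (s : S) := let: (k, (N, q, W)) := s in
  [/\ (0 < N)%N, is_chain V (eps k) N q W, q 0%N = a & q N = b].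
pose next (s s' : S) := let: (k, (N, q, W)) := s in let: (k', (N', q',
  W')) := s' in
  k' = k.+1 /\ exists2 n, (0 < n)%N & N' = (N * n)%N /\
  forall m, (m < N * n)%N -> W' m `<=` W (m %/ n)%N.
have /choice[F FP] : forall s, exists s', good s -> good s' /\ next s s'.
  move=> [k [[N q] W]].
  have [[N0 qW qa qb]|] := pselect (good (k, (N, q, W)));
    last by exists (k, (N, q, W)).
  have [n [q' [W' [n0 qW' WW' [q'0 q'N]]]]] := chain_refinement qW (eps0 k.+1).
  exists (k.+1, (N * n, q', W'))%N => _; split; last by split=> //; exists n.
  by split; rewrite ?muln_gt0 ?N0 // ?q'0 // q'N.
have [n1 n1P] := chained_connected oV cV (eps0 0%N) Va Vb.
have [q0 [W0 [qW0 q00 q0n]]] := n1P n1.+1 (leqnSn _).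
pose st k := iter k F (0%N, (n1.+1, q0, W0)).
have st_good k : good (st k) by elim: k => [//|k /FP[]].
have st_next k : next (st k) (st k.+1) by have [_] := FP _ (st_good k).
have st_idx k : (st k).1 = k.
  elim: k => [//|k IH]; have := st_next k;
    case: (st k.+1) => [k'' [[N' q'] W']].
  by case: (st k) IH => [k' [[N q] W]] /= -> [].
pose NN k := (st k).2.1.1; pose q k := (st k).2.1.2; pose W k := (st k).2.2.
have goodP k : [/\ (0 < NN k)%N, is_chain V (eps k) (NN k) (q k) (W k),
    q k 0%N = a & q k (NN k) = b].
  have := st_good k; have := st_idx k; rewrite /NN /q /W.
  by case: (st k) => [k' [[N q'] W']] /= ->.
have nextP k : exists2 n, (0 < n)%N & NN k.+1 = (NN k * n)%N /\
    forall m, (m < NN k * n)%N -> W k.+1 m `<=` W k (m %/ n)%N.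
  have := st_next k; rewrite /NN /W.
  by case: (st k) => [k' [[N q'] W']]; case: (st k.+1) => [? [[N' q''] W'']] [].
(* At stage [k] the chain is run through at constant speed over [NN k] equal intervals; the index at
   1 is [NN k], whose point is [b]. *)
pose idx k (t : K) := Num.truncn (t * (NN k)%:R).
pose g k t := q k (idx k t).
have NN0 k : (0 : K) < (NN k)%:R by rewrite ltr0n; case: (goodP k).
have tN0 k (t : K) : 0 <= t <= 1 -> 0 <= t * (NN k)%:R.
  by move=> /andP[t0 _]; rewrite mulr_ge0 // ltW.
have idx_le k (t : K) : 0 <= t <= 1 -> (idx k t <= NN k)%N.
  move=> t01; rewrite -(ler_nat K); have /truncn_itv/andP[+ _] := tN0 k t t01.
  by move=> /le_trans; apply; rewrite ler_piMl ?(ltW (NN0 k)) //;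
    case/andP: t01.
have gV k (t : K) : 0 <= t <= 1 -> V (g k t).
  move=> t01; rewrite /g; have := idx_le k t t01; have [_ qW _ qb] := goodP k.
  rewrite leq_eqVlt => /predU1P[->|/qW[_ _ WV [_ Wq _]]]; last exact: WV.
  by rewrite qb.
have g_next k (t : K) : 0 <= t <= 1 -> d (g k t) (g k.+1 t) < eps k.
  move=> t01; have [n n0 [NE WW]] := nextP k.
  have idxE : (idx k.+1 t %/ n)%N = idx k t.
    by rewrite /idx NE natrM mulrA truncn_div // tN0.
  have [_ qW _ qb] := goodP k; have [_ qW' _ qb'] := goodP k.+1.
  have := idx_le k.+1 t t01; rewrite leq_eqVlt => /predU1P[it|it].
    have : idx k t = NN k by rewrite -idxE it NE mulnK.
    by rewrite /g it => ->; rewrite qb qb' d_refl.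
  have [_ _ _ [_ W'q _]] := qW' _ it.
  rewrite NE in it; have {}W'q := WW _ it _ W'q; rewrite idxE in W'q.
  have /qW[_ _ _ [sW Wq _]] : (idx k t < NN k)%N by rewrite -idxE ltn_divLR.
  exact: sW.
(* The gaps between successive stages are bounded by a geometric series, which telescopes. *)
have g_cauchy k l (t : K) : 0 <= t <= 1 ->
  d (g k t) (g (k + l)%N t) <= 2 * eps k - 2 * eps (k + l)%N.
  move=> t01; elim: l => [|l IH]; first by rewrite addn0 d_refl subrr.
  have := dtri (g k t) (g (k + l)%N t) (g (k + l.+1)%N t).
  have := g_next (k + l)%N t t01; rewrite addnS.
  by have := epsS (k + l)%N; lra.
(* The limit is a cluster point, provided by compactness of [L]. *)
have /choice[gam gamP] : forall t : K, exists y, 0 <= t <= 1 ->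
    L y /\ forall k, d (g k t) y <= 2 * eps k.
  move=> t; have [t01|] := boolP (0 <= t <= 1); last by exists a.
  have [|y [Ly gy]] := cL ((fun k => g k t) @ \oo) _.
    by exists 0%N => // k _; exact/VL/gV.
  exists y => _; split=> // k; apply/ler_addgt0Pr => e e0.
  have [||z [[l kl <-]] /= ye] := gy ((fun l => g l t) @` [set l | (k <= l)%N])
      [set z | d y z < e].
  - by exists k => // l kl; exists l.
  - by apply/dnbhs; exists e.
  have := dtri (g k t) (g l t) y; have := g_cauchy k (l - k)%N t t01.
  by rewrite subnKC //; rewrite (dC y) in ye; have := eps0 l; lra.
have gam_eq (t : K) y : 0 <= t <= 1 -> (forall k, g k t = y) -> gam t = y.
  move=> t01 gy; apply/esym/d0/eqP; rewrite eq_le d_ge0 andbT.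
  apply/ler_addgt0Pr => e e0; rewrite add0r;
    have [|k ke] := @half_expr_small _ (e / 2); first lra.
  by have := (gamP t t01).2 k; rewrite gy /eps; lra.
exists gam; split.
- apply: gam_eq => [|k]; first by rewrite lexx ler01.
  by rewrite /g /idx mul0r truncn0; case: (goodP k).
- apply: gam_eq => [|k]; first by rewrite lexx ler01.
  by rewrite /g /idx mul1r natrK; case: (goodP k).
- by move=> t /gamP[].
(* The fifth accounts for two limits, each costing [2 * eps k], and one link, costing [eps k]. *)
move=> t e t01 e0; have [|k ke] := @half_expr_small _ (e / 5); first lra.
exists (NN k)%:R^-1; first by rewrite invr_gt0.
(* Parameters closer than one interval have indices that differ by at most one, so their points lie
   in a common link. *)
have close (u v : K) : 0 <= u <= 1 -> 0 <= v <= 1 -> u <= v ->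
  v - u < (NN k)%:R^-1 ->
    d (g k u) (g k v) < eps k.
  move=> u01 v01 uv vu; have [_ qW _ _] := goodP k; rewrite /g.
  have /truncn_itv/andP[lu uu] := tN0 k u u01.
  have /truncn_itv/andP[lv uv'] := tN0 k v v01.
  have vu' : v * (NN k)%:R < u * (NN k)%:R + 1.
    by rewrite -ltrBlDl -mulrBl -ltr_pdivlMr // mul1r.
  have uv1 : (idx k u <= idx k v)%N.
    by apply: le_truncn; rewrite ler_pM2r.
  have uv2 : (idx k v <= (idx k u).+1)%N.
    rewrite -ltnS -(ltr_nat K); apply: le_lt_trans lv _.
    by rewrite -natr1; apply: lt_trans vu' _; rewrite ltrD2r.
  have [uvE|/eqP uvE] := eqVneq (idx k u) (idx k v);
    first by rewrite uvE d_refl.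
  have uvS : idx k v = (idx k u).+1.
    by apply/eqP; rewrite eqn_leq uv2 ltn_neqAle uv1 andbT; exact/eqP.
  have /qW[_ _ _ [sW W1 W2]] : (idx k u < NN k)%N by rewrite -uvS;
    exact: idx_le.
  by rewrite uvS; exact: sW.
move=> t' t'01 tt'.
have tt'd : d (g k t) (g k t') < eps k.
  have [le_tt'|/ltW le_t't] := leP t t'; first by apply: close => //;
    rewrite -normrN opprB ger0_norm ?subr_ge0 // in tt'.
  by rewrite dC; apply: close => //; rewrite ger0_norm ?subr_ge0 // in tt'.
have := dtri (gam t) (g k t) (gam t'); have := dtri (g k t) (g k t') (gam t').
have := (gamP t t01).2 k; have := (gamP t' t'01).2 k.
by rewrite (dC (gam t) (g k t)); move: ke tt'd; rewrite -/(eps k); lra.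
Qed.

End metric_paths.

(** * Locally constant functions and singular 1-simplices *)

Section simplex_paths.
Variable K : realType.

Lemma matrix_continuous (T : topologicalType) (m n : nat) (f : T -> 'M[K]_(m,
  n)) :
  (forall i j, continuous (fun t => f t i j)) -> continuous f.
Proof.
move=> fc t A [P nP sPA]; apply: (@filterS _ _ _ _ _ (fun u Pu => sPA _ Pu)).
apply: filter_forall => i; apply: filter_forall => j.
exact/fc/nP.
Qed.

(** This barycentric coordinate identifies the 1-simplex with the unit interval. The face [ord0]
    omits vertex 0 and so has weight 1. *)
Definition weight (u : simplex K 1) : K := val u 0 ord_max.

Lemma weight_continuous : continuous weight.
Proof.
move=> u A /(@coord_continuous K 1 2 0 ord_max).
exact: (@initial_continuous _ _ (val : simplex K 1 -> 'rV[K]_2) u).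
Qed.

Lemma simplex1_sum (u : simplex K 1) : val u 0 ord0 = 1 - weight u.
Proof.
have /set_mem[_] := valP u; rewrite /weight big_ord_recr big_ord1 /= => <-.
by rewrite (_ : widen_ord _ _ = ord0) ?addrK //; exact: val_inj.
Qed.

Lemma weight_itv (u : simplex K 1) : 0 <= weight u <= 1.
Proof.
rewrite -[_ <= 1]subr_ge0 -simplex1_sum /weight.
by have /set_mem[u0 _] := valP u; rewrite !u0.
Qed.

Lemma weight0 : weight (face ord0 (vertex0 K)) = 1.
Proof.
rewrite /weight /= mxE; have ->
  : ord_max = lift ord0 ord0 :> 'I_2 by exact: val_inj.
by rewrite liftK /= mxE.
Qed.

Lemma weight1 : weight (face (lift ord0 ord0) (vertex0 K)) = 0.
Proof.
rewrite /weight /= mxE; have ->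
  : ord_max = lift ord0 ord0 :> 'I_2 by exact: val_inj.
by rewrite unlift_none.
Qed.

Let clip (t : K) : K := Num.max 0 (Num.min 1 t).

Let clip_itv t : 0 <= clip t <= 1.
Proof. by rewrite /clip le_max lexx /= ge_max ler01 ge_min lexx. Qed.

Let segment_row (t : K) : 'rV[K]_2 :=
  \row_j (if j == ord0 then 1 - clip t else clip t).

Let segment_subproof t : segment_row t \in @simplex_set K 1.
Proof.
have /andP[c0 c1] := clip_itv t.
apply/mem_set; split=> [i|];
  last by rewrite big_ord_recl big_ord1 !mxE /= subrK.
by rewrite mxE; case: eqP; rewrite ?subr_ge0.
Qed.

Lemma connected_simplex1 : connected [set: simplex K 1].
Proof.
pose f (t : K) : simplex K 1 :=
  exist (fun u => u \in @simplex_set K 1) _ (segment_subproof t).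
have clip_cont : continuous clip.
  move=> t; apply: continuous_max; first exact: cst_continuous.
  by apply: continuous_min; [exact: cst_continuous|].
have f_cont : continuous f.
  apply: continuous_comp_initial; apply: matrix_continuous => i j.
  rewrite [X in continuous X](_ : _ = fun t =>
    if j == ord0 then 1 - clip t else clip t).
    case: eqP => _ //; move=> t; apply: continuousB;
      first exact: cst_continuous.
    exact: clip_cont.
  by apply/funext => t; rewrite /= mxE.
have -> : [set: simplex K 1] = f @` `[0, 1]%classic.
  apply/seteqP; split=> // u _; exists (weight u).
    by rewrite /= in_itv /= weight_itv.
  have /andP[w0 w1] := weight_itv u.
  have cw : clip (weight u) = weight u by rewrite /clip min_r // max_r.
  apply: val_inj; apply/rowP => j; rewrite !mxE cw -simplex1_sum.
  case: eqP => [->//|/eqP j0]; congr (val u _ _).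
  by apply/val_inj; case: j j0 => [[|[|[]]]].
apply: connected_continuous_connected; first exact: segment_connected.
exact: continuous_subspaceT.
Qed.

(** Quantifying over connected subsets rather than components makes the passage to a smaller set
    immediate. *)
Definition connectedly_constant (X : topologicalType) (T : Type) (U : set X)
    (f : X -> T) :=
  forall C : set X, C `<=` U -> connected C -> {in C &, forall x y, f x = f y}.

Lemma connectedly_path_constant (X : topologicalType) (T : Type) (U : set X)
    (f : X -> T) : connectedly_constant U f -> path_constant K U f.
Proof.
move=> fU s; apply: (fU (range (sval s))).
- exact: (svalP s).
- apply: connected_continuous_connected; first exact: connected_simplex1.
  by apply: continuous_subspaceT; exact: cts_fun.
- by apply/mem_set; exists (face ord0 (vertex0 K)).
- by apply/mem_set; exists (face (lift ord0 ord0) (vertex0 K)).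
Qed.

Lemma locally_connectedly_constant (X : topologicalType) (T : Type) (U : set X)
    (f : X -> T) :
  (forall x, U x -> exists V, [/\ open V, V x & forall y, V y -> f y = f x]) ->
  connectedly_constant U f.
Proof.
move=> floc C CU cC x y /set_mem Cx /set_mem Cy.
have {}floc z : exists V, U z -> [/\ open V, V z & forall y, V y -> f y = f z].
  by have [/floc[V]|] := pselect (U z); [exists V|exists set0].
have /choice[V VP] := floc.
(* On [C] the open set [O P] is the preimage of [P]; taking a singleton and its complement, each
   level set is clopen in [C]. *)
pose O (P : set T) := \bigcup_(z in [set z | U z /\ P (f z)]) V z.
have oO P : open (O P) by apply: bigcup_open => z [/VP[]].
have CO P z : C z -> O P z <-> P (f z).
  move=> Cz; split; last by move=> Pz; exists z; [split=> //;
    exact: CU|case: (VP z (CU _ Cz))].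
  by move=> [w [Uw Pw] Vz]; have [_ _ ->] := VP w Uw.
have : C `&` O [set f x] = C.
  apply: cC.
  - by exists x; split=> //; exact/CO.
  - by exists (O [set f x]).
  - exists (~` O (~` [set f x])); first exact: open_closedC.
    apply/seteqP; split=> z [Cz Oz]; split=> //.
      by move=> /(CO _ _ Cz); apply; exact/CO.
    by apply/CO => //; apply: contrapT => nz; apply: Oz; exact/CO.
by move=> E; have : C y by []; rewrite -{1}E => -[_ /CO -> //].
Qed.

(** Near each point, Mazurkiewicz's paths stay in a compact ball inside [U], so [f] is locally
    constant on [U]. *)
Lemma path_constant_connected (X : topologicalType) (T : Type) (U : set X)
    (f : X -> T) :
  metrizable K X -> locally_connected X -> locally_compact [set: X] -> open U ->
  path_constant K U f -> connectedly_constant U f.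
Proof.
move=> [d [d0 dC dtri dnbhs]] lcX lkX oU fU.
apply: locally_connectedly_constant => x Ux.
have [Q xQ [cQ clQ]] := lkX x I.
have {}xQ : nbhs x Q.
  by apply: (@filterS _ (nbhs x) _ [set y | [set: X] y -> Q y]) xQ => y; exact.
have /dnbhs[e e0 eUQ] : nbhs x (U `&` Q).
  by apply: filterI => //; exact: open_nbhs_nbhs.
(* The closed ball of half the radius lies in [U] and in the compactum [Q], hence is compact; it
   will hold the paths. *)
pose L := [set y | d x y <= e / 2].
have clL : closed L.
  rewrite -openC openE => y /= /negP; rewrite -ltNge => ey; apply/dnbhs.
  exists (d x y - e / 2); first by rewrite subr_gt0.
  move=> z /= yz; apply/negP; rewrite -ltNge.
  by have := dtri x z y; rewrite (dC z y); lra.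
have LUQ : L `<=` U `&` Q by move=> y Ly; apply: eUQ; rewrite /L /= in Ly *;
  lra.
have cL : compact L.
  by apply: subclosed_compact clL cQ _ => y /LUQ[].
have [V [oV Vx VL cV]] : exists C, [/\ open C, C x,
    C `<=` [set y | d x y < e / 2] & connected C].
  by apply: lcX; apply/dnbhs; exists (e / 2) => //; rewrite divr_gt0.
have {}VL : V `<=` L by move=> y /VL /ltW.
exists V; split=> // y Vy.
have [g [g0 g1 gL gc]] := path_in_connected d0 dC dtri dnbhs lcX oV cV VL cL Vx
  Vy.
pose s (u : simplex K 1) := g (weight u).
have s_cont : continuous s.
  move=> u A /dnbhs[r r0 rA].
  have [q q0 qr] := gc _ _ (weight_itv u) r0.
  have : nbhs u (weight @^-1` ball (weight u) q).
    by apply: weight_continuous; exact: nbhsx_ballx.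
  by apply: filterS => v /= uv; apply/rA/qr => //; exact: weight_itv.
pose sC := HB.pack_for (continuousType (simplex K 1) X) s
  (isContinuous.Build _ _ s s_cont).
have sU : range (sC : continuousType (simplex K 1) X) `<=` U.
  by move=> _ [u _ <-]; have [] := LUQ _ (gL _ (weight_itv u)).
have := fU (exist (fun s : continuousType (simplex K 1) X =>
  range s `<=` U) sC sU).
by rewrite /= /s weight0 weight1 g0 g1.
Qed.

End simplex_paths.

(** * Unbounded components, ends and rays *)

Section components.
Variables (X : topologicalType).
Implicit Types A C : set X.

Lemma component_ofE A C x : component_of A C -> C x ->
  C = connected_component A x.
Proof. by move=> [y Ay ->] /same_connected_component. Qed.

Lemma component_of_sub A C : component_of A C -> C `<=` A.
Proof. by move=> [x _ ->]; exact: connected_component_sub. Qed.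

Lemma component_of_connected A C : component_of A C -> connected C.
Proof. by move=> [x _ ->]; exact: component_connected. Qed.

Lemma component_of_nonempty A C : component_of A C -> exists x, C x.
Proof. by move=> [x Ax ->]; exists x; exact: connected_component_refl. Qed.

Lemma component_of_component A x : A x ->
  component_of A (connected_component A x).
Proof. by exists x. Qed.

Lemma connected_component_open A x : locally_connected X -> open A ->
  open (connected_component A x).
Proof.
move=> lcX oA; rewrite openE => y Axy.
have Ay : A y := connected_component_sub Axy.
have [C [oC Cy CA cC]] := lcX y A (open_nbhs_nbhs (conj oA Ay)).
apply: (filterS _ (open_nbhs_nbhs (conj oC Cy))).
by rewrite (same_connected_component Axy); exact: connected_component_max.
Qed.

End components.

Section exhaustions.
Variable X : topologicalType.
Hypotheses (hX : hausdorff_space X) (cX : connected [set: X]).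
Hypothesis lcX : locally_connected X.
Variable L : nat -> set X.
Hypothesis LX : compact_exhaustion L.

Let L_compact i : compact (L i). Proof. by case: LX. Qed.
Let L_interior i : L i `<=` interior (L i.+1). Proof. by case: LX. Qed.

Lemma exhaustion_closed i : closed (L i).
Proof. exact: compact_closed. Qed.

Lemma exhaustion_mono i j : (i <= j)%N -> L i `<=` L j.
Proof.
elim: j => [|j IH]; first by rewrite leqn0 => /eqP ->.
rewrite leq_eqVlt => /predU1P[->//|]; rewrite ltnS => /IH ij.
by apply: subset_trans ij _ => x /L_interior /interior_subset.
Qed.

Lemma exhaustion_absorbs (M : set X) : compact M -> exists k, M `<=` L k.
Proof.
move=> cM; apply: (compact_union_ind (P := fun A => exists k, A `<=` L k) cM).
- by exists 0%N.
- by move=> A B AB [k Bk]; exists k; exact: subset_trans Bk.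
- move=> A B [k Ak] [l Bl]; exists (maxn k l) => x [/Ak|/Bl].
    exact/exhaustion_mono/leq_maxl.
  exact/exhaustion_mono/leq_maxr.
move=> x _; have [_ _ Lcover] := LX.
have [k _ Lkx] : (\bigcup_i L i) x by rewrite Lcover.
by exists (L k.+1); [exact: L_interior|exists k.+1].
Qed.

Lemma exhaustion_complement_open i : open (~` L i).
Proof. exact/closed_openC/exhaustion_closed. Qed.

Definition unbounded_component i : set (set X) :=
  [set C | component_of (~` L i) C /\ unbounded C].

Lemma unbounded_sub (A B : set X) : A `<=` B -> unbounded A -> unbounded B.
Proof.
move=> AB uA cB; apply: uA; apply: subclosed_compact cB _;
  first exact: closed_closure.
exact: closureS.
Qed.

Lemma unbounded_not_sub (A M : set X) : unbounded A -> compact M ->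
  ~ (A `<=` M).
Proof.
move=> uA cM AM; apply: uA; apply: (subclosed_compact _ cM);
  first exact: closed_closure.
by rewrite [M in _ `<=` M](closure_id _).1;
  [exact: closureS|exact: compact_closed].
Qed.

Let frontier i := L i.+1 `\` interior (L i.+1).

(* A component of [~` L i] that reaches beyond [L i.+1] must cross the frontier
   of [L i.+1], for otherwise it is clopen in [X]. *)
Lemma component_crosses i C : component_of (~` L i) C -> ~ C `<=` L i.+1 ->
  C = [set: X] \/ exists2 x, frontier i x & C x.
Proof.
move=> CC CL; have [|nx] := pselect (exists2 x, frontier i x & C x);
  first by right.
(* The part of [C] outside [L i.+1] is nonempty and, as [C] misses the frontier, clopen in [C]. *)
left; have CLi : C `<=` ~` L i.+1.
  suff <- : C `&` ~` L i.+1 = C by move=> x [].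
  apply: (component_of_connected CC).
  - have /existsNP[x /not_implyP[Cx Lx]] := CL; by exists x.
  - by exists (~` L i.+1) => //; exact: exhaustion_complement_open.
  - exists (~` interior (L i.+1)).
      by apply: open_closedC; exact: open_interior.
    apply/seteqP; split=> x [Cx Lx]; split=> //.
      by move=> /interior_subset.
    by move=> Lx'; apply: nx; exists x.
(* A limit point of [C] in [L i] would have the interior of [L i.+1] as a neighbourhood, which [C]
   misses. *)
have clC : closure C `<=` C.
  have [y Cy] := component_of_nonempty CC.
  rewrite {2}(component_ofE CC Cy); apply: connected_component_max.
  - exact: subset_closure.
  - move=> x Cx Lx; have [z [Cz]] := Cx _ (L_interior Lx).
    exact: CLi.
  - exact/connected_closure/component_of_connected/CC.
apply: cX.
- exact: component_of_nonempty CC.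
- exists C; last by rewrite setTI.
  case: CC => x _ ->; apply: connected_component_open => //.
  exact: exhaustion_complement_open.
- exists C; last by rewrite setTI.
  by rewrite closure_id; apply/seteqP; split=> //; exact: subset_closure.
Qed.

(** The frontier is compact and covered by disjoint open components, so it meets finitely many; the
    case of the whole space adds at most one. *)
Lemma outer_components_finite i :
  finite_set [set C | component_of (~` L i) C /\ ~ C `<=` L i.+1].
Proof.
have cF : compact (frontier i).
  apply: compact_closedI => //; apply: open_closedC; exact: open_interior.
pose P A := finite_set [set C | component_of (~` L i) C /\ exists2 x,
  A x & C x].
have : P (frontier i).
  apply: (compact_union_ind (P := P) cF).
  - by apply: (sub_finite_set _ (@finite_set0 _)) => C [_ []].
  - by move=> A B AB; apply: sub_finite_set => C [CC [x Ax Cx]]; split=> //;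
      exists x => //; exact: AB.
  - move=> A B PA PB; apply: (@sub_finite_set _ _ (_ `|` _));
      last by rewrite finite_setU; split; [exact: PA|exact: PB].
    by move=> C [CC [x [Ax|Bx] Cx]]; [left|right]; split=> //; exists x.
  move=> x [_ Lx]; have Ux : (~` L i) x by move=> /L_interior.
  exists (connected_component (~` L i) x).
    apply: open_nbhs_nbhs; split; last exact: connected_component_refl.
    by apply: connected_component_open => //; exact: exhaustion_complement_open.
  apply: (sub_finite_set _ (finite_set1 (connected_component (~` L i) x))).
  by move=> C [CC [y xy Cy]] /=; rewrite (component_ofE CC Cy);
    apply/esym/same_connected_component.
move=> finF; apply: (@sub_finite_set _ _ ([set [set: X]] `|` _)); last first.
  by rewrite finite_setU; split; [exact: finite_set1|exact: finF].
by move=> C [CC CL]; have [->|] := component_crosses CC CL; [left|right].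
Qed.

Lemma unbounded_component_finite i : finite_set (unbounded_component i).
Proof.
apply: sub_finite_set (outer_components_finite i) => C [CC uC]; split=> //.
exact: unbounded_not_sub.
Qed.

Lemma unbounded_component_cover i : exists2 M, compact M &
  forall x, ~ M x -> exists2 C, unbounded_component i C & C x.
Proof.
have [s sE] := (finite_seqP _).1 (outer_components_finite i).
(* Only finitely many bounded components leave [L i.+1], so adding their closures keeps the set
   compact. *)
pose M := L i.+1 `|` \big[setU/set0]_(C <- s | `[< compact (closure C) >])
  closure C.
exists M.
  by apply: compactU => //; apply: bigsetU_compact => C /asboolP.
move=> x /not_orP[Lx Mx]; have Ux : (~` L i) x by move=> /(exhaustion_mono
  (leqnSn i)).
have Cx := connected_component_refl Ux.
exists (connected_component (~` L i) x) => //; split;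
  first exact: component_of_component.
move=> cC; apply: Mx; rewrite -bigcup_seq_cond.
exists (connected_component (~` L i) x); last exact: subset_closure.
apply/andP; split; last exact/asboolP.
have : [set C | component_of (~` L i) C /\
  ~ C `<=` L i.+1] (connected_component (~` L i) x).
  by split; [exact: component_of_component|move=> /(_ x Cx)].
by rewrite sE.
Qed.

(** The union avoids choosing a point; for a component [C] of a later complement it is the single
    component that contains [C]. *)
Definition enclosing_component i (C : set X) : set X :=
  \bigcup_(x in C) connected_component (~` L i) x.

Lemma enclosing_componentE i j C x : (i <= j)%N ->
  component_of (~` L j) C -> C x ->
  enclosing_component i C = connected_component (~` L i) x.
Proof.
move=> ij CC Cx; have CLi : C `<=` ~` L i.
  by move=> y /(component_of_sub CC) Ly /(exhaustion_mono ij).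
apply/seteqP; split=> [y [z Cz zy]|y xy]; last by exists x.
apply: connected_component_trans zy.
by apply: (connected_component_max Cx CLi) => //;
  exact: component_of_connected CC.
Qed.

Lemma sub_enclosing_component i j C : (i <= j)%N -> component_of (~` L j) C ->
  C `<=` enclosing_component i C.
Proof.
move=> ij CC x Cx; exists x => //; apply: connected_component_refl => Lx.
exact: (component_of_sub CC Cx) (exhaustion_mono ij Lx).
Qed.

Lemma enclosing_unbounded i C : unbounded_component i.+1 C ->
  unbounded_component i (enclosing_component i C).
Proof.
move=> [CC uC]; have [x Cx] := component_of_nonempty CC.
split; last exact: unbounded_sub (sub_enclosing_component (leqnSn i) CC) uC.
rewrite (enclosing_componentE (leqnSn i) CC Cx); apply: component_of_component.
by move=> /(exhaustion_mono (leqnSn i)); exact: component_of_sub CC _ Cx.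
Qed.

Lemma enclosing_eq i C D : component_of (~` L i.+1) D ->
  component_of (~` L i) C ->
  (enclosing_component i D = C <-> D `<=` C).
Proof.
move=> DD CC; split=> [<-|DC]; first exact: sub_enclosing_component DD.
have [x Dx] := component_of_nonempty DD.
by rewrite (enclosing_componentE (leqnSn i) DD Dx) (component_ofE CC (DC _ Dx)).
Qed.

(** An unbounded [C] leaves the compactum outside which each point lies in an unbounded component of
    the next level. *)
Lemma enclosing_surj i C : unbounded_component i C ->
  exists2 D, unbounded_component i.+1 D & enclosing_component i D = C.
Proof.
move=> [CC uC]; have [M cM Mcover] := unbounded_component_cover i.+1.
have /existsNP[x /not_implyP[Cx Mx]] := unbounded_not_sub uC cM.
have [D [DD uD] Dx] := Mcover x Mx; exists D => //.
by rewrite (enclosing_componentE (leqnSn i) DD Dx) (component_ofE CC Cx).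
Qed.

Lemma ends_threads : ends L = threads unbounded_component enclosing_component.
Proof.
apply/seteqP; split=> W EW i.
  have [CC uC WW] := EW i; have [CC' _ _] := EW i.+1.
  by split=> //; apply/enclosing_eq.
have [[CC uC] WE] := EW i; have [[CC' _] _] := EW i.+1.
by split=> //; exact: (enclosing_eq CC' CC).1.
Qed.

End exhaustions.

Lemma exhaustion_exists (X : topologicalType) : sigma_compact X ->
  locally_compact [set: X] -> exists L : nat -> set X, compact_exhaustion L.
Proof.
move=> [M [cM Mcover]] lkX.
(* The implication sits inside the existential so that choice yields an enlargement function on all
   sets. *)
have enlarge (A : set X) : exists B,
  compact A -> compact B /\ A `<=` interior B.
  have [cA|] := pselect (compact A); last by exists set0.
  have [B [cB AB]] : exists B, compact B /\ A `<=` interior B.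
    apply: (compact_union_ind (P := fun A =>
      exists B, compact B /\ A `<=` interior B) cA).
    - by exists set0; split=> //; exact: compact0.
    - by move=> A1 A2 A12 [B [cB A2B]]; exists B; split=> //;
        exact: subset_trans A2B.
    - move=> A1 A2 [B1 [cB1 AB1]] [B2 [cB2 AB2]]; exists (B1 `|` B2).
      split; first exact: compactU.
      move=> x [/AB1|/AB2]; apply: interiorS; [exact: subsetUl|exact: subsetUr].
    move=> x _; have [Q xQ [cQ _]] := lkX x I.
    have {}xQ : nbhs x Q.
      by apply: (@filterS _ (nbhs x) _ [set y | [set: X] y -> Q y]) xQ => y;
        exact.
    by exists (interior Q); [exact: nbhs_interior|exists Q; split].
  by exists B.
have {enlarge}/choice[F FP] := enlarge.
pose L := fix L n := if n is m.+1 then F (L m `|` M m) else set0.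
have cL n : compact (L n).
  by elim: n => [|n IH] /=; [exact: compact0|have [] :=
    FP _ (compactU IH (cM n))].
have LS n : L n `|` M n `<=` interior (L n.+1) by have [] :=
  FP _ (compactU (cL n) (cM n)).
exists L; split=> //.
- by move=> n; exact: subset_trans (LS n).
- apply/seteqP; split=> // x _;
    have [n _ Mx] : (\bigcup_i M i) x by rewrite Mcover.
  by exists n.+1; [|have := LS n x (or_intror Mx); exact: interior_subset].
Qed.

(** * Tails of a ray and the end that they determine *)

Section rays.
Variables (K : realType).
Implicit Types X : ray_space K.

Lemma half_line_above (T : K) : exists t : half_line K, T < val t.
Proof.
have H : Num.max 0 T + 1 \in `[(0 : K), +oo[%classic.
  by apply/mem_set; rewrite /= in_itv /= andbT addr_ge0 // le_max lexx.
exists (exist (fun u => u \in `[(0 : K), +oo[%classic) _ H) => /=.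
by rewrite ltr_pwDr // le_max lexx orbT.
Qed.

Lemma ray_leaves_compact X (M : set X) : compact M ->
  exists T : K, forall t, T < val t -> ~ M (rs_ray X t).
Proof.
move=> /(@rs_proper _ X) cM.
have : compact (val @` (rs_ray X @^-1` M) : set K).
  apply: continuous_compact cM; apply: continuous_subspaceT.
  exact: initial_continuous.
move=> /(@compact_bounded K K^o) [B [_ HB]]; exists (B + 1) => t Bt Mt.
have /(_ (val t)) := HB (B + 1) ltac:(by rewrite ltrDl).
by move=> /(_ (ex_intro2 _ _ t Mt erefl));
  rewrite /= => /(le_trans (ler_norm _)); rewrite leNgt Bt.
Qed.

Lemma interpolation_continuous (T : topologicalType) (f : T -> K) (a b : K) :
  continuous f -> continuous (fun u => (1 - f u) * a + f u * b).
Proof.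
move=> fc u; apply: (@cvgD K K^o).
  apply: cvgM; last exact: cvg_cst.
  by apply: (@cvgB K K^o); [exact: cvg_cst|exact: fc].
by apply: cvgM; [exact: fc|exact: cvg_cst].
Qed.

(** The parameter moves affinely from [t0] to [t1], so it stays beyond [T]. *)
Lemma ray_segment X (T : K) (t0 t1 : half_line K) : T < val t0 -> T < val t1 ->
  exists s : continuousType (simplex K 1) X,
    [/\ range s `<=` rs_ray X @` [set t | T < val t],
      s (face ord0 (vertex0 K)) = rs_ray X t1 &
      s (face (lift ord0 ord0) (vertex0 K)) = rs_ray X t0].
Proof.
move=> Tt0 Tt1.
pose c (u : simplex K 1) : K := (1 - weight u) * val t0 + weight u * val t1.
have c_ge u (a : K) : a <= val t0 -> a <= val t1 -> a <= c u.
  move=> at0 at1; have /andP[w0 w1] := weight_itv u; rewrite /c; nra.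
have c0 u : c u \in `[(0 : K), +oo[%classic.
  apply/mem_set; rewrite /= in_itv /= andbT; apply: c_ge.
    by have /set_mem := valP t0; rewrite /= in_itv /= andbT.
  by have /set_mem := valP t1; rewrite /= in_itv /= andbT.
pose l (u : simplex K 1) : half_line K :=
  exist (fun u => u \in `[(0 : K), +oo[%classic) _ (c0 u).
have cc : continuous c by apply: interpolation_continuous;
  exact: weight_continuous.
have lc : continuous l by apply: continuous_comp_initial; exact: cc.
have [rc _ _] := rs_embedding X.
have sc : continuous (rs_ray X \o l).
  by move=> u; apply: continuous_comp; [exact: lc|exact: rc].
exists (HB.pack_for (continuousType (simplex K 1) X) (rs_ray X \o l)
  (isContinuous.Build _ _ _ sc)); split.
- move=> _ [u _ <-]; exists (l u) => //=.
  have : Num.min (val t0) (val t1) <= c u by apply: c_ge;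
    rewrite ge_min lexx ?orbT.
  by apply: lt_le_trans; rewrite lt_min Tt0.
- by congr (rs_ray X _); apply: val_inj;
    rewrite /= /c weight0 subrr mul0r add0r mul1r.
- by congr (rs_ray X _); apply: val_inj;
    rewrite /= /c weight1 subr0 mul0r addr0 mul1r.
Qed.

Lemma ray_unbounded X (T : K) (C : set X) :
  (forall t, T < val t -> C (rs_ray X t)) -> unbounded C.
Proof.
move=> TC cC; have [T' T'C] := ray_leaves_compact cC.
have [t] := half_line_above (Num.max T T'); rewrite gt_max => /andP[Tt T't].
exact/(T'C t T't)/subset_closure/TC.
Qed.

(** A tail of the ray misses [L i] and is joined by paths, hence lies in one component. These
    components are nested because the tails meet, and unbounded because the ray leaves every
    compactum. *)
Lemma ray_end X (L : nat -> set X) : compact_exhaustion L ->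
  exists e, ends L e /\
    forall i, exists T : K, forall t, T < val t -> e i (rs_ray X t).
Proof.
move=> LX; have [hX cX lcX _ _] := rs_continuum X.
have /choice[e eP] : forall i, exists C, component_of (~` L i) C /\
    exists T : K, forall t, T < val t -> C (rs_ray X t).
  move=> i; have [cL _ _] := LX; have [T TL] := ray_leaves_compact (cL i).
  have [t0 Tt0] := half_line_above T.
  exists (connected_component (~` L i) (rs_ray X t0)); split.
    exact/component_of_component/TL.
  exists T => t Tt; have [s [sT s0 s1]] := ray_segment X Tt0 Tt.
  apply: (@connected_component_max _ _ (range s)).
  - by rewrite -s1; exists (face (lift ord0 ord0) (vertex0 K)).
  - by move=> _ /sT [u /TL uL <-].
  - apply: connected_continuous_connected; first exact: connected_simplex1.
    by apply: continuous_subspaceT; exact: cts_fun.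
  - by rewrite -s0; exists (face ord0 (vertex0 K)).
exists e; split=> [i|i]; last by have [] := eP i.
have [CC [T TC]] := eP i; have [CC' [T' T'C]] := eP i.+1.
split=> //; first exact: ray_unbounded TC.
have [t] := half_line_above (Num.max T T'); rewrite gt_max => /andP[Tt T't].
have sub : e i.+1 `<=` ~` L i.
  by move=> x /(component_of_sub CC') Lx /(exhaustion_mono LX (leqnSn i)).
rewrite (component_ofE CC (TC _ Tt)).
apply: (connected_component_max (T'C _ T't) sub).
exact: component_of_connected CC'.
Qed.

End rays.

(** * End cohomology of a ray-based space *)

Lemma countable_setU1 (T : Type) (A : set T) (x : T) : countable A ->
  countable (x |` A).
Proof.
move=> cA; have -> : x |` A =
  \bigcup_(b in [set: bool]) (if b then [set x] else A).
  apply/seteqP; split=> [y [yx|Ay]|y [[] _]].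
  - by exists true.
  - by exists false.
  - by left.
  - by right.
by apply: bigcup_countable => [//|[] _]; [exact: countable1|].
Qed.

Section germ_facts.
Variables (K : realType) (R : nzRingType) (X : topologicalType) (S A : set X).
Local Notation H := (end_cohomology K R S A 0).

Lemma represents_inj (x y : H) f : represents x f -> represents y f -> x = y.
Proof.
by move=> xf yf; apply/(represents_eq xf yf); exists (compact_inh S).
Qed.

Lemma represents0 : represents (0 : H) (fun=> 0).
Proof.
have [|//|z zf] := @represents_intro K R X S A (compact_inh S) (fun=> 0) _ _.
  by [].
have := represents_linear (-1) zf zf; rewrite scaleN1r addNr.
by congr (represents _ _); apply/funext => t; rewrite mulr0 addr0.
Qed.

Lemma represents_scale (x : H) f a : represents x f ->
  represents (a *: x) (fun z => a * f z).
Proof.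
move=> xf; have := represents_linear a xf represents0; rewrite addr0.
by congr (represents _ _); apply/funext => t; rewrite addr0.
Qed.

Lemma path_constant_sub (T : Type) (U V : set X) (f : X -> T) : V `<=` U ->
  path_constant K U f -> path_constant K V f.
Proof.
move=> VU fU [s sV].
exact: (fU (exist (fun s : continuousType (simplex K 1) X => range s `<=` U) s
  (subset_trans sV VU))).
Qed.

End germ_facts.

Section ray_cohomology.
Variables (K : realType) (R : idomainType).
Implicit Types X Y : ray_space K.

Lemma constant_class_exists X : exists x : He R 0 X, represents x (fun=> 1).
Proof. by apply: (@represents_intro _ _ _ _ _ (compact_inh setT)). Qed.

Definition constant_class X : He R 0 X := sval (cid (constant_class_exists X)).

Lemma constant_classP X : represents (constant_class X) (fun=> 1).
Proof. exact: svalP (cid (constant_class_exists X)). Qed.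

Lemma ray_class_exists X : exists x : He_ray R 0 X, represents x (fun=> 1).
Proof. by apply: (@represents_intro _ _ _ _ _ (compact_inh (ray_image X))). Qed.

Definition ray_class X : He_ray R 0 X := sval (cid (ray_class_exists X)).

Lemma ray_classP X : represents (ray_class X) (fun=> 1).
Proof. exact: svalP (cid (ray_class_exists X)). Qed.

Lemma restrict_constant_class X :
  restrict_ray R 0 X (constant_class X) = ray_class X.
Proof.
exact: represents_inj (represents_map (ray_map_incl (ray_id X))
  (constant_classP X))
  (ray_classP X).
Qed.

Lemma He_map_constant_class Y X (f : ray_map Y X) :
  He_map R 0 f (constant_class X) = constant_class Y.
Proof.
exact: represents_inj (represents_map (ray_map_abs f) (constant_classP X))
  (constant_classP Y).
Qed.

Lemma He_ray_map_ray_class Y X (f : ray_map Y X) :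
  He_ray_map R 0 f (ray_class X) = ray_class Y.
Proof.
exact: represents_inj (represents_map (ray_map_ends f) (ray_classP X))
  (ray_classP Y).
Qed.

Lemma half_line_segment_compact (T : K) :
  compact [set t : half_line K | val t <= T].
Proof.
have max_itv (t : K) : Num.max 0 t \in `[(0 : K), +oo[%classic.
  by apply/mem_set; rewrite /= in_itv /= andbT le_max lexx.
pose f (t : K) : half_line K := exist (fun u =>
  u \in `[(0 : K), +oo[%classic) _ (max_itv t).
have fc : continuous f.
  apply: continuous_comp_initial => t.
  by apply: continuous_max; [exact: cst_continuous|].
have -> : [set t : half_line K | val t <= T] = f @` `[0, T]%classic.
  apply/seteqP; split=> [t tT|_ [t /= /[!in_itv] /= /andP[t0 tT] <-]];
    last first.
    by rewrite /= max_r.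
  have /set_mem := valP t; rewrite /= in_itv /= andbT => t0.
  exists (val t); first by rewrite /= in_itv /= t0.
  by apply: val_inj; rewrite /= max_r.
by apply: continuous_compact;
  [exact: continuous_subspaceT|exact: segment_compact].
Qed.

Lemma ray_segment_compact X (T : K) :
  compact (rs_ray X @` [set t : half_line K | val t <= T]).
Proof.
apply: continuous_compact; last exact: half_line_segment_compact.
by apply: continuous_subspaceT; case: (rs_embedding X).
Qed.

(** A representative is constant along a tail, any two points of which are joined by a path; the
    initial segment is absorbed in a compactum. *)
Lemma ray_class_gen X (z : He_ray R 0 X) : exists a, z = a *: ray_class X.
Proof.
have [f zf] := represents_exists z;
  have [[L [cL LX]] [fpath _]] := represents_cocycle zf.
have [T TL] := ray_leaves_compact cL; have [t0 Tt0] := half_line_above T.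
exists (f (rs_ray X t0)).
apply/(represents_eq zf (represents_scale _ (ray_classP X))).
have cN := @ray_segment_compact X T.
have NX : rs_ray X @` [set t : half_line K | val t <= T] `<=` ray_image X by
  move=> _ [t _ <-]; exists t.
exists (exist (fun L => compact L /\ L `<=` ray_image X) _ (conj cN NX)).
move=> _ [/= [t _ <-] /= tN]; rewrite mulr1.
have [tT|Tt] := leP (val t) T; first by case: tN; exists t.
have [s [sT s0 s1]] := ray_segment X Tt0 Tt.
rewrite -s0 -s1.
have sL : range s `<=` ray_image X `\` L.
  by move=> _ /sT[u Tu <-]; split; [exists u|exact: TL].
exact: (fpath (exist (fun s : continuousType (simplex K 1) X =>
  range s `<=` _) s sL)).
Qed.

Lemma ray_class_free X a : a *: ray_class X = 0 -> a = 0.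
Proof.
move=> /(represents_eq (represents_scale a (ray_classP X)) (represents0 _ _ _
  _)).
move=> [[L [cL LX]] /= aL]; have [T TL] := ray_leaves_compact cL.
have [t Tt] := half_line_above T.
by rewrite -[LHS]mulr1; apply: (aL (rs_ray X t)); split; [exists t|exact: TL].
Qed.

Definition ray_coef X (z : He_ray R 0 X) : R := sval (cid (ray_class_gen z)).

Lemma ray_coefE X (z : He_ray R 0 X) : ray_coef z *: ray_class X = z.
Proof. exact/esym/(svalP (cid (ray_class_gen z))). Qed.

Lemma ray_coefZ X a : ray_coef (a *: ray_class X) = a.
Proof.
apply/eqP; rewrite -subr_eq0; apply/eqP/(@ray_class_free X).
by rewrite scalerBl ray_coefE subrr.
Qed.

Lemma ray_coefP X a (y z : He_ray R 0 X) :
  ray_coef (a *: y + z) = a * ray_coef y + ray_coef z.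
Proof. by rewrite -{1}(ray_coefE y) -{1}(ray_coefE z) scalerA -scalerDl
  ray_coefZ. Qed.

(** The constant 1 on the ray is lifted to the constant 1 on the space. Naturality follows, as
    composing a constant with a map returns it. *)
Definition ray_section X (z : He_ray R 0 X) : He R 0 X :=
  ray_coef z *: constant_class X.

Fact ray_section_linear X : linear (@ray_section X).
Proof. by move=> a y z; rewrite /ray_section ray_coefP scalerDl scalerA. Qed.

HB.instance Definition _ X :=
  GRing.isLinear.Build R (He_ray R 0 X) (He R 0 X) _ (@ray_section X)
    (@ray_section_linear X).

Lemma ray_sectionK X (z : He_ray R 0 X) : restrict_ray R 0 X (ray_section z) =
  z.
Proof. by rewrite /ray_section linearZ /= restrict_constant_class ray_coefE.
  Qed.

Lemma ray_section_natural Y X (f : ray_map Y X) (z : He_ray R 0 X) :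
  He_map R 0 f (ray_section z) = ray_section (He_ray_map R 0 f z).
Proof.
rewrite /ray_section linearZ /= He_map_constant_class.
by rewrite -{2}(ray_coefE z) linearZ /= He_ray_map_ray_class ray_coefZ.
Qed.

Lemma He_ray_basis X : is_basis [set ray_class X].
Proof.
have [] := @dual_basis R (He_ray R 0 X) unit setT (fun=> ray_class X)
  (fun=> @ray_coef X) _ _ _.
- by move=> _ _; exact: ray_coefP.
- by move=> [] [] _ _; rewrite -[ray_class X]scale1r ray_coefZ.
- move=> x; exists [:: tt], setT; split=> // y _ /(_ tt (mem_head _ _)) y0.
  by rewrite -(ray_coefE y) y0 scale0r.
move=> + _; congr is_basis; apply/seteqP; split=> [_ [_ _ <-]|_ ->] //.
by exists tt.
Qed.

Lemma represents_forget X (x : He_reduced R 0 X) f : represents x f ->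
  represents (forget_ray R 0 X x) f.
Proof. exact: (represents_map (ray_map_absrel (ray_id X))). Qed.

Lemma represents_restrict X (x : He R 0 X) f : represents x f ->
  represents (restrict_ray R 0 X x) f.
Proof. exact: (represents_map (ray_map_incl (ray_id X))). Qed.

(** Both maps keep the representing function. One that vanishes on the ray near infinity represents
    a reduced class after the compactum is enlarged. *)
Lemma forget_ray_short_exact X : short_exact (forget_ray R 0 X) (restrict_ray R
  0 X).
Proof.
split.
- move=> x y; have [f xf] := represents_exists x;
    have [g yg] := represents_exists y.
  move=> /(represents_eq (represents_forget xf) (represents_forget yg)).
  by move=> /(represents_eq xf yg).
- move=> y; split=> [y0|[x <-]].
    have [f yf] := represents_exists y.
    have [[L [cL LX]] [fpath _]] := represents_cocycle yf.
    have := represents_restrict yf;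
      rewrite y0 => /represents_eq/(_ (represents0 _ _ _ _)).
    move=> [/(_ erefl) [[M [cM MX]] /= fM] _].
    pose N : compact_in [set: X] :=
      exist (fun L => compact L /\ L `<=` [set: X]) _ (conj (compactU cL cM)
        (@subsetT _ _)).
    have [||x xf] := @represents_intro K R X setT (ray_image X) N f.
    - by apply: path_constant_sub fpath => z [_ /= LMz]; split=> // Lz;
        apply: LMz; left.
    - by move=> z rz [_ /= LMz]; apply: fM; split=> // Mz; apply: LMz; right.
    by exists x; exact: represents_inj (represents_forget xf) yf.
  have [f xf] := represents_exists x.
  have [[L [cL LX]] [_ f0]] := represents_cocycle xf.
  apply/(represents_eq (represents_restrict (represents_forget xf))
    (represents0 _ _ _ _)).
  have cLr := @compact_ray_image_preimage K X X (ray_id X) L cL.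
  exists (exist (fun L => compact L /\
    L `<=` ray_image X) _ (conj cLr (@subIsetl _ _ _))).
  move=> z [rz /= Lz]; apply: f0 => //; split=> //= Lz'; apply: Lz; split=> //.
- by move=> z; exists (ray_section z); exact: ray_sectionK.
Qed.

(** * The basis of the reduced module and the number of ends *)

Section reduced_basis.
Variables (X : ray_space K) (L : nat -> set X).
Hypothesis LX : compact_exhaustion L.

Let hX : hausdorff_space X. Proof. by case: (rs_continuum X). Qed.
Let cX : connected [set: X]. Proof. by case: (rs_continuum X). Qed.
Let lcX : locally_connected X. Proof. by case: (rs_continuum X). Qed.
Let lkX : locally_compact [set: X]. Proof. by case: (rs_continuum X). Qed.

Local Notation U := (unbounded_component L).
Local Notation p := (enclosing_component L).

Lemma connectedly_constant_mono (i j : nat) (f : X -> R) : (i <= j)%N ->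
  connectedly_constant (~` L i) f -> connectedly_constant (~` L j) f.
Proof.
move=> ij fi C CLj; apply: fi => x /CLj Lx /(exhaustion_mono LX ij).
exact: Lx.
Qed.

Lemma represents_level (x : He_reduced R 0 X) f : represents x f ->
  exists i, connectedly_constant (~` L i) f /\
    forall z, ray_image X z -> ~ L i z -> f z = 0.
Proof.
move=> xf; have [[M [cM MX]] [fpath f0]] := represents_cocycle xf.
have [i Mi] := exhaustion_absorbs LX cM; exists i; split; last first.
  by move=> z rz Lz; apply: f0 => //; split=> //= /Mi.
apply: (path_constant_connected (rs_metrizable X)) => //.
  exact: exhaustion_complement_open.
by apply: path_constant_sub fpath => z Lz; split=> //= /Mi.
Qed.

(** The eventual value of a representative along the end [W]; [end_valueP] shows that neither the
    representative nor the level matters. *)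
Definition end_value (W : nat -> set X) (x : He_reduced R 0 X) : R :=
  xget 0 [set v | exists f k, represents x f /\ forall y, W k y -> f y = v].

Lemma end_anti W i j : ends L W -> (i <= j)%N -> W j `<=` W i.
Proof.
move=> EW; elim: j => [|j IH]; first by rewrite leqn0 => /eqP ->.
rewrite leq_eqVlt => /predU1P[->//|]; rewrite ltnS => /IH.
by apply: subset_trans; have [] := EW j.
Qed.

(** Two representatives agree outside a compactum, and [W n] lies outside it for [n] large. *)
Lemma end_valueP W x f k v : ends L W -> represents x f ->
  (forall y, W k y -> f y = v) -> end_value W x = v.
Proof.
move=> EW xf fv; rewrite /end_value;
  case: xgetP => [w _ [g [l [xg gw]]]|/(_ v)]; last first.
  by case; exists f, k.
have [[M [cM MX]] fg] := (represents_eq xf xg).1 erefl.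
have [m Mm] := exhaustion_absorbs LX cM.
pose n := maxn k (maxn l m).
have [Wn _ _] := EW n; have [y Wy] := component_of_nonempty Wn.
have Wk : W k y by apply: (end_anti EW) Wy; rewrite leq_maxl.
have Wl : W l y by apply: (end_anti EW) Wy; rewrite /n maxnCA leq_maxl.
rewrite -(fv y Wk) -(gw y Wl); apply/esym/fg; split=> //= /Mm.
have mn : (m <= n)%N by rewrite /n maxnA leq_maxr.
by move=> /(exhaustion_mono LX mn); exact: component_of_sub Wn _ Wy.
Qed.

Lemma end_value_exists W x : ends L W -> exists f k,
  represents x f /\ forall y, W k y -> f y = end_value W x.
Proof.
move=> EW; have [f xf] := represents_exists x.
have [i [fi _]] := represents_level xf; have [Wi _ _] := EW i.
have [y0 Wy0] := component_of_nonempty Wi.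
have fy0 y : W i y -> f y = f y0.
  move=> Wy; apply: (fi (W i)); [exact: component_of_sub Wi| |exact/mem_set..].
  exact: component_of_connected Wi.
by exists f, i; split=> // y Wy; rewrite (end_valueP EW xf fy0) fy0.
Qed.

Lemma end_value_linear W a x y : ends L W ->
  end_value W (a *: x + y) = a * end_value W x + end_value W y.
Proof.
move=> EW; have [f [k [xf fk]]] := end_value_exists x EW.
have [g [l [yg gl]]] := end_value_exists y EW.
apply: (end_valueP (k := maxn k l) EW (represents_linear a xf yg)) => z Wz.
rewrite fk ?gl //; apply: (end_anti EW) Wz; [exact: leq_maxr|exact: leq_maxl].
Qed.

(** The indicator represents a reduced class only if it vanishes along the ray near infinity, hence
    the default 0. *)
Definition component_class (b : nat * set X) : He_reduced R 0 X :=
  xget 0 [set x | represents x (fun z => (`[< b.2 z >])%:R)].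

Lemma component_indicator i C : component_of (~` L i) C ->
  connectedly_constant (~` L i) (fun z => (`[< C z >])%:R : R).
Proof.
move=> CC D DL cD x y /set_mem Dx /set_mem Dy.
suff xy u v : D u -> D v -> C u -> C v.
  by congr (_%:R); congr nat_of_bool; apply/asboolP/asboolP; exact: xy.
move=> Du Dv Cu; rewrite (component_ofE CC Cu).
exact: connected_component_max Du DL cD _ Dv.
Qed.

Section with_ray_end.
Variable e : nat -> set X.
Hypothesis e_end : ends L e.
Hypothesis e_ray : forall i, exists T : K, forall t,
  T < val t -> e i (rs_ray X t).

Lemma component_classP i C : U i C -> C <> e i ->
  represents (component_class (i, C)) (fun z => (`[< C z >])%:R).
Proof.
move=> [CC _] Ce; rewrite /component_class; case: xgetP => // /(_ _) nC.
have [eC _ _] := e_end i; have [cL _ _] := LX.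
(* Beyond [T] the ray runs in [e i], which is disjoint from [C]; the part up to [T] goes into the
   compactum. *)
have [T Te] := e_ray i.
have cM := compactU (cL i) (@ray_segment_compact X T).
pose N : compact_in [set: X] :=
  exist (fun L => compact L /\ L `<=` [set: X]) _ (conj cM (@subsetT _ _)).
have [||x xC] := @represents_intro K R X setT (ray_image X) N
    (fun z => (`[< C z >])%:R); last by case: (nC x).
  apply: (@path_constant_sub _ _ _ (~` L i)).
    by move=> z [_ /= Nz] Lz; apply: Nz; left.
  exact/connectedly_path_constant/component_indicator.
move=> _ [t _ <-] [_ /= Nt]; rewrite asboolF // => Ct; apply: Ce.
have [tT|Tt] := leP (val t) T; first by case: Nt; right; exists t.
by rewrite (component_ofE CC Ct) -(component_ofE eC (Te _ Tt)).
Qed.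

Lemma end_value_component W i C : ends L W -> U i C -> C <> e i ->
  end_value W (component_class (i, C)) = (W i == C)%:R.
Proof.
move=> EW UC Ce; apply: (end_valueP (k := i) EW (component_classP UC Ce)) =>
  y Wy.
have [WC _ _] := EW i; have [CC _] := UC.
congr (_%:R); congr nat_of_bool; apply/asboolP/eqP => [Cy|<-//].
by rewrite (component_ofE CC Cy) -(component_ofE WC Wy).
Qed.

Let U_finite i : finite_set (U i). Proof. exact: unbounded_component_finite.
  Qed.

Let p_sub i C : U i.+1 C -> U i (p i C).
Proof. exact: enclosing_unbounded. Qed.

Let p_surj i C : U i C -> exists2 D, U i.+1 D & p i D = C.
Proof. exact: enclosing_surj. Qed.

Let e_thread : threads U p e. Proof. by rewrite -ends_threads. Qed.

(** [dual_basis] applies with [P] the classes constant on components at level [i], and [s] the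
    finitely many branching vertices up to that level. If these functionals vanish on such a class,
    its values on all threads equal the one on [e], which is 0. *)
Lemma He_reduced_basis :
  let B := branching U p e in
  is_basis (component_class @` B) /\ {in B &, injective component_class}.
Proof.
move=> B.
have B_end b : B b -> ends L (thread_of U p e b.1 b.2) /\
  ends L (parent_thread U p e b.1 b.2).
  move=> [Ub _]; rewrite ends_threads //; split.
    exact: (thread_ofP p_sub p_surj e_thread Ub).1.
  exact: (parent_threadP p_sub p_surj e_thread Ub).
have B_neq b : B b -> b.2 <> e b.1 by case: b => i C /(branching_neq e_thread).
apply: (@dual_basis R (He_reduced R 0 X) _ B component_class (fun b x =>
  end_value (thread_of U p e b.1 b.2) x - end_value (parent_thread U p e b.1
    b.2) x)).
- move=> b /B_end[E1 E2] a x y; rewrite !end_value_linear //.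
  by rewrite mulrBr opprD addrACA.
- move=> b [j D] Bb Bc; have [E1 E2] := B_end _ Bb; have [UD _] := Bc.
  rewrite !end_value_component //; try exact: (B_neq _ Bc).
  exact: (branching_dual p_sub p_surj e_thread R Bb Bc).
move=> x; have [f xf] := represents_exists x;
  have [i [fi _]] := represents_level xf.
have [s sE] := (finite_seqP _).1 (branching_finite_level p U_finite e i).
exists s, [set y | exists g, represents y g /\ connectedly_constant (~` L i) g].
have sB b : b \in s -> B b /\ (b.1 <= i)%N.
  by move=> bs; have : [set` s] b by []; rewrite -sE.
split.
- by move=> b /sB[].
- by exists f.
- move=> [j C] /sB[Bb ji]; have [[CC uC] _] := Bb.
  exists (fun z => (`[< C z >])%:R); split.
    by apply: component_classP => //; exact: B_neq _ Bb.
  exact/(connectedly_constant_mono ji)/component_indicator.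
- move=> a y z [g [yg gi]] [h [zh hi]].
  exists (fun z => a * g z + h z); split; first exact: represents_linear.
  by move=> C CL cC u v Cu Cv;
    rewrite (gi C CL cC u v Cu Cv) (hi C CL cC u v Cu Cv).
move=> y [g [yg gi]] lam0.
have value_of W : ends L W -> forall z, W i z -> g z = end_value W y.
  move=> EW z Wz; apply/esym/(end_valueP (k := i) EW yg) => u Wu;
    have [WC _ _] := EW i.
  apply: (gi (W i)); [exact: component_of_sub WC| |exact/mem_set..].
  exact: component_of_connected WC.
(* A reduced class vanishes on the ray near infinity, and the ray ends up in every [e i]. *)
have e0 : end_value e y = 0.
  have [j [_ g0]] := represents_level yg.
  have [cL _ _] := LX; have [T TL] := ray_leaves_compact (cL j).
  have [T' Te] := e_ray i; have [t] := half_line_above (Num.max T T').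
  rewrite gt_max => /andP[Tt T't].
  rewrite -(value_of e e_end _ (Te _ T't)); apply: g0; first by exists t.
  exact: TL.
have ker := branching_kernel (phi := fun W =>
  end_value W y) (i := i) p_sub e0 _.
(* Points outside the unbounded components lie in the compactum [M], which does not affect the
   class. *)
have [M cM Mcover] := unbounded_component_cover hX cX lcX LX i.
apply/(represents_eq yg (represents0 _ _ _ _)).
exists (exist (fun L => compact L /\
  L `<=` [set: X]) _ (conj cM (@subsetT _ _))).
move=> z [_ /= Mz]; have [C UC Cz] := Mcover z Mz.
have [EC Ci] := thread_ofP p_sub p_surj e_thread UC.
rewrite (value_of (thread_of U p e i C));
  [|by rewrite ends_threads|by rewrite Ci].
apply: ker (leqnn i) UC => b Bb bi; apply/eqP; rewrite -subr_eq0; apply/eqP.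
by apply: lam0; have : [set` s] b by rewrite -sE.
Qed.

End with_ray_end.

Lemma reduced_basis_ends : exists B : set (He_reduced R 0 X),
  [/\ is_basis B, countable B &
    counting (ends L) = (counting B + 1)%E :> \bar K].
Proof.
have [e [e_end e_ray]] := ray_end LX.
have [bas inj] := He_reduced_basis e_end e_ray.
exists (component_class @` branching U p e); split=> //.
- apply: sub_countable (card_image_le _ _) _; apply: branching_countable.
  by move=> i; exact: unbounded_component_finite.
- rewrite (counting_image K inj) (ends_threads _) //.
  apply: counting_threads.
  + by move=> i C; exact: enclosing_unbounded.
  + by move=> i C; exact: enclosing_surj.
  + by rewrite -ends_threads.
Qed.

End reduced_basis.

End ray_cohomology.

Theorem theorem7p7 (K : realType) (R : idomainType)
    (pidR : principal_ideal_domain R) :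
  (forall X : ray_space K,
    [/\ free_of_countable_rank (He_ray R 0 X),
        free_of_countable_rank (He R 0 X),
        free_of_countable_rank (He_reduced R 0 X),
        short_exact (forget_ray R 0 X) (restrict_ray R 0 X) &
        (forall L : nat -> set X, compact_exhaustion L ->
           counting (ends L) = module_rank (He R 0 X) K) /\
        module_rank (He R 0 X) K = (module_rank (He_reduced R 0 X) K + 1)%E]) /\
  (exists s : forall X : ray_space K, {linear He_ray R 0 X -> He R 0 X},
    (forall (X : ray_space K) (x : He_ray R 0 X),
       restrict_ray R 0 X (s X x) = x) /\
    (forall (Y X : ray_space K) (f : ray_map Y X) (x : He_ray R 0 X),
       He_map R 0 f (s X x) = s Y (He_ray_map R 0 f x))).
Proof.
split; last first.
  exists (fun X => @ray_section K R X); split=> [X x|Y X f x].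
    exact: ray_sectionK.
  exact: ray_section_natural.
move=> X; have [_ _ _ scX lkX] := rs_continuum X.
have [L0 L0X] := exhaustion_exists scX lkX.
(* Adding the class of 1 turns any basis of the reduced module into one of the absolute module, with
   one more element. *)
have extend (B : set (He_reduced R 0 X)) : is_basis B ->
    is_basis (constant_class R X |` forget_ray R 0 X @` B) /\
    counting (constant_class R X |` forget_ray R 0 X @` B) =
      (counting B + 1)%E :> \bar K.
  move=> basB; have [f_inj fg _] := forget_ray_short_exact R X.
  have [] := @split_extension_basis R _ _ _ (forget_ray R 0 X) (restrict_ray R
    0 X)
    (constant_class R X) B f_inj fg _ _ basB.
  - by move=> a; rewrite restrict_constant_class; exact: ray_class_free.
  - by move=> z; rewrite restrict_constant_class; exact: ray_class_gen.
  move=> bas nu; split=> //; rewrite counting_setU1 // counting_image // =>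
    x y _ _.
  exact: f_inj.
have [B [basB cB _]] := reduced_basis_ends R L0X.
have [basB1 B1E] := extend B basB.
split.
- by exists [set ray_class R X]; split; [exact: He_ray_basis|exact: countable1].
- exists (constant_class R X |` forget_ray R 0 X @` B); split=> //.
  by apply: countable_setU1; apply: sub_countable (card_image_le _ _) cB.
- by exists B.
- exact: forget_ray_short_exact.
rewrite (module_rankE K basB1) (module_rankE K basB); split=> // L LX.
(* Each exhaustion [L] brings its own reduced basis; invariance of the rank compares it with [B]. *)
have [B' [basB' _ ->]] := reduced_basis_ends R LX.
by rewrite B1E (counting_basis K basB basB').
Qed.
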